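(* Let $(M,g)$ be a Lorentzian manifold of dimension $n\ge3$, $c$ a null congruence on $M$, and $S_{ab}=S_{ba}$ a rank 2 symmetric tensor field of type N with boost order $-2$ along $c$, i.e. $\mathrm{bo}_c(S)=-2$ (at every point). If $\mathrm{bo}_c(\nabla\nabla S)\le 0$, then $c$ is geodetic. If moreover $\mathrm{bo}_c(\nabla\nabla\nabla S)\le0$, then $c$ is Kundt.
   Context: Lorentzian metrics have signature $(-,+,\dots,+)$ and $\nabla$ is the Levi-Civita connection. A null congruence $c$ (equivalently null line distribution) is a smooth rank-one subbundle of $TM$ whose fibres are null lines. With $k$ a local non-vanishing section of $c$: $c$ is geodetic if $k^a\nabla_ak^b\propto k^b$; $c$ is Kundt (non-twisting, hence geodetic, non-shearing and non-expanding) if $X^a\nabla_ak^b\propto k^b$ for all $X\in c^\perp$, equivalently $k_{[a}\nabla_{b]}k_{[c}k_{d]}=0$. Boost order: at each point take a null frame $\{e_0,e_1,e_i\}=\{k,l,m_i\}$ ($2\le i\le n-1$) with $0\ne k\in c$, whose only non-zero inner products are $g(k,l)=g(m_i,m_i)=1$. The boost weight of a multi-index $\alpha_1\cdots\alpha_r$ is (number of $0$'s) minus (number of $1$'s). The boost order $\mathrm{bo}_c(T)$ of a non-zero covariant tensor $T$ is the largest boost weight of a multi-index with $T_{\alpha_1\cdots\alpha_r}=T(e_{\alpha_1},\dots,e_{\alpha_r})\ne0$ (independent of the frame); the zero tensor is regarded as having boost order $\le s$ for every $s$. Conditions on boost orders of tensor fields are meant at every point. A symmetric rank 2 tensor is of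 type N exactly when it has boost order $-2$ along some (then unique) null line. *)

(* Defs.v *)
(* MathComp / MathComp-Analysis development.

   Smooth manifolds are given by atlases, and tensor fields by their components
   in the charts together with the transformation law on overlaps.  Points of
   coordinate space and (components of) tangent vectors are row vectors
   'rV[R]_n.  All component functions are total; only their values on the image
   of the chart are meaningful. *)
From mathcomp Require Import all_boot all_order all_algebra.
From mathcomp Require Import all_classical all_reals topology normedtype derive.
From mathcomp Require Import ring.

Set Implicit Arguments.
Unset Strict Implicit.
Unset Printing Implicit Defensive.

Import Order.TTheory GRing.Theory Num.Theory.
Import numFieldNormedType.Exports.

Local Open Scope classical_set_scope.
Local Open Scope ring_scope.

Section Calculus.
Variables (R : realType) (n : nat).

Definition pd (a : 'I_n) (f : 'rV[R]_n -> R) : 'rV[R]_n -> R :=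
  fun x => 'D_(delta_mx 0 a) f x.

(* Class C^oo on an open set U: all iterated partial derivatives (of every
   order, including 0) exist and are continuous at every point of U. *)
Definition smooth (U : set 'rV[R]_n) (f : 'rV[R]_n -> R) : Prop :=
  forall (s : seq 'I_n) (x : 'rV[R]_n), U x ->
    {for x, continuous (foldr pd f s)} /\
    forall a, derivable (foldr pd f s) x (delta_mx 0 a).

Definition smoothv (m : nat) (U : set 'rV[R]_n) (f : 'rV[R]_n -> 'rV[R]_m) :=
  forall b, smooth U (fun x => f x 0 b).

End Calculus.

Section Manifolds.
Variables (R : realType) (n : nat).

(* A homeomorphism from the open set dom of M onto the open set cod of R^n,
   with its inverse; chart_map and chart_inv are junk outside dom and cod. *)
Record chart (M : topologicalType) := Chart {
  dom : set M;
  cod : set 'rV[R]_n;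
  chart_map : M -> 'rV[R]_n;
  chart_inv : 'rV[R]_n -> M;
  dom_open : open dom;
  cod_open : open cod;
  chart_map_cod : forall p, dom p -> cod (chart_map p);
  chart_inv_dom : forall x, cod x -> dom (chart_inv x);
  chart_mapK : forall p, dom p -> chart_inv (chart_map p) = p;
  chart_invK : forall x, cod x -> chart_map (chart_inv x) = x;
  chart_map_continuous : forall p, dom p -> {for p, continuous chart_map};
  chart_inv_continuous : forall x, cod x -> {for x, continuous chart_inv} }.

Definition overlap (M : topologicalType) (u v : chart M) : set 'rV[R]_n :=
  [set x | cod u x /\ dom v (chart_inv u x)].

Definition transition (M : topologicalType) (u v : chart M) :
  'rV[R]_n -> 'rV[R]_n := fun x => chart_map v (chart_inv u x).

Record manifold := Manifold {
  points :> topologicalType;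
  points_hausdorff : hausdorff_space points;
  points_second_countable : @second_countable points;
  chart_index : Type;
  atlas : chart_index -> chart points;
  atlas_cover : forall p : points, exists i, dom (atlas i) p;
  atlas_smooth : forall i j,
    smoothv (overlap (atlas i) (atlas j)) (transition (atlas i) (atlas j)) }.

Variable M : manifold.
Implicit Types i j : chart_index M.

(* Entry (a, b) is the derivative of the b-th new coordinate along the a-th old
   one, so that vectors transform by v |-> v *m jac i j x. *)
Definition jac i j (x : 'rV[R]_n) : 'M[R]_n :=
  \matrix_(a, b) pd a (fun y => transition (atlas i) (atlas j) y 0 b) x.

(* Components T_{b_1...b_r} of a covariant tensor of rank r. *)
Definition tensor (r : nat) := {ffun 'I_r -> 'I_n} -> R.

Record tensor_field (r : nat) := TensorField {
  components :> chart_index M -> 'rV[R]_n -> tensor r;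
  components_smooth : forall i b, smooth (cod (atlas i)) (fun x => components i x b);
  components_transform : forall i j x (b : {ffun 'I_r -> 'I_n}),
    overlap (atlas i) (atlas j) x ->
    components i x b =
      \sum_(c : {ffun 'I_r -> 'I_n})
        (\prod_(s < r) jac i j x (b s) (c s)) *
        components j (transition (atlas i) (atlas j) x) c }.

Definition idx2 (a b : 'I_n) : {ffun 'I_2 -> 'I_n} :=
  [ffun s => if s == ord0 then a else b].

Definition mx_of_tensor (T : tensor 2) : 'M[R]_n :=
  \matrix_(a, b) T (idx2 a b).

Definition symmetric_field (S : tensor_field 2) :=
  forall i x, cod (atlas i) x ->
    forall a b, S i x (idx2 a b) = S i x (idx2 b a).

Definition lorentzian_mx (G : 'M[R]_n) : Prop :=
  exists2 P : 'M[R]_n, P \in unitmx &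
    P *m G *m P^T = diag_mx (\row_(a < n) if a == 0%N :> nat then -1 else 1).

Record lorentzian_metric := LorentzianMetric {
  metric_field :> tensor_field 2;
  metric_sym : symmetric_field metric_field;
  metric_lorentzian : forall i x, cod (atlas i) x ->
    lorentzian_mx (mx_of_tensor (metric_field i x)) }.

Definition gram (g : lorentzian_metric) i (x : 'rV[R]_n) : 'M[R]_n :=
  mx_of_tensor (g i x).

Definition inner (G : 'M[R]_n) (u v : 'rV[R]_n) : R := (u *m G *m v^T) 0 0.

(* A smooth rank one subbundle of the tangent bundle; fibre i x is the set of
   component vectors, in the chart i, of the fibre over the point x. *)
Record line_field := LineField {
  fibre : chart_index M -> 'rV[R]_n -> set 'rV[R]_n;
  fibre_transform : forall i j x v, overlap (atlas i) (atlas j) x ->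
    fibre i x v <->
    fibre j (transition (atlas i) (atlas j) x) (v *m jac i j x);
  fibre_frame : forall i x0, cod (atlas i) x0 ->
    exists (U : set 'rV[R]_n) (k : 'rV[R]_n -> 'rV[R]_n),
      [/\ open U, U x0, U `<=` cod (atlas i), smoothv U k &
          forall x, U x -> k x != 0 /\ fibre i x = [set a *: k x | a in setT]] }.

Definition null_congruence (g : lorentzian_metric) (c : line_field) :=
  forall i x v, cod (atlas i) x -> fibre c i x v -> inner (gram g i x) v v = 0.

Definition local_section (c : line_field) i (U : set 'rV[R]_n)
    (k : 'rV[R]_n -> 'rV[R]_n) : Prop :=
  [/\ open U, U `<=` cod (atlas i), smoothv U k &
      forall x, U x -> k x != 0 /\ fibre c i x (k x)].

End Manifolds.

Section LeviCivita.
Variables (R : realType) (n : nat).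

(* The Christoffel symbol Gamma^c_{ab} of the Levi-Civita connection of the
   metric whose component matrix at x is G x. *)
Definition christoffel (G : 'rV[R]_n -> 'M[R]_n) (x : 'rV[R]_n)
    (c a b : 'I_n) : R :=
  2^-1 * \sum_d invmx (G x) c d *
    (pd a (fun y => G y d b) x + pd b (fun y => G y d a) x
     - pd d (fun y => G y a b) x).

Definition idx_tail (r : nat) (b : {ffun 'I_r.+1 -> 'I_n}) :
  {ffun 'I_r -> 'I_n} := [ffun s => b (lift ord0 s)].

Definition idx_set (r : nat) (b : {ffun 'I_r -> 'I_n}) (s : 'I_r) (d : 'I_n) :
  {ffun 'I_r -> 'I_n} := [ffun t => if t == s then d else b t].

(* (nabla T)_{a b_1...b_r} = nabla_a T_{b_1...b_r}: the index of the derivative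
   comes first. *)
Definition covd (G : 'rV[R]_n -> 'M[R]_n) (r : nat) (T : 'rV[R]_n -> tensor R n r) :
  'rV[R]_n -> tensor R n r.+1 :=
  fun x b =>
    pd (b ord0) (fun y => T y (idx_tail b)) x
    - \sum_(s < r) \sum_d
        christoffel G x d (b ord0) (idx_tail b s) * T x (idx_set (idx_tail b) s d).

(* (nabla_X k)^b = X^a (d_a k^b + Gamma^b_{ac} k^c). *)
Definition covd_vect (G : 'rV[R]_n -> 'M[R]_n) (k : 'rV[R]_n -> 'rV[R]_n)
    (x X : 'rV[R]_n) : 'rV[R]_n :=
  \row_b \sum_a X 0 a *
    (pd a (fun y => k y 0 b) x + \sum_c christoffel G x b a c * k x 0 c).

End LeviCivita.

Section LeviCivitaMetric.
Variables (R : realType) (n : nat) (M : manifold R n) (g : lorentzian_metric M).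
Implicit Types i : chart_index M.

Lemma gram_tr i x : cod (atlas i) x -> (gram g i x)^T = gram g i x.
Proof. by move=> ix; apply/matrixP => a b; rewrite !mxE metric_sym. Qed.

Lemma gram_unit i x : cod (atlas i) x -> gram g i x \in unitmx.
Proof.
move=> /(@metric_lorentzian _ _ _ g)[P Pu PGP].
have : P *m gram g i x *m P^T \in unitmx.
  rewrite PGP unitmxE det_diag unitfE; apply/prodf_neq0 => a _.
  by rewrite mxE; case: ifP; rewrite ?oppr_eq0 oner_eq0.
by rewrite !unitmx_mul => /andP[/andP[]].
Qed.

Lemma pd_gramC i x a b d : cod (atlas i) x ->
  pd d (fun y => gram g i y a b) x = pd d (fun y => gram g i y b a) x.
Proof.
move=> ix; apply: near_eq_derive.
have : nbhs x (cod (atlas i)) by apply: open_nbhs_nbhs; split => //; exact: cod_open.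
by apply: filterS => y iy; rewrite -[in LHS](gram_tr iy) mxE.
Qed.

(* The two characteristic properties of the Levi-Civita connection: it is
   torsion-free and the metric is parallel. *)
Lemma christoffelC i x c a b : cod (atlas i) x ->
  christoffel (gram g i) x c a b = christoffel (gram g i) x c b a.
Proof.
move=> ix; rewrite /christoffel; congr (_ * _).
apply: eq_bigr => d _; congr (_ * _); rewrite [X in X - _]addrC; congr (_ - _).
exact: pd_gramC.
Qed.

Lemma covd_metric i x b : cod (atlas i) x -> covd (gram g i) (g i) x b = 0.
Proof.
move=> ix; set G := gram g i.
have GT : (G x)^T = G x by exact: gram_tr.
have low a p q : \sum_d christoffel G x d a p * G x d q = 2^-1 *
    (pd a (fun y => G y q p) x + pd p (fun y => G y q a) x
     - pd q (fun y => G y a p) x).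
  under eq_bigr do rewrite -mulrA mulr_suml.
  rewrite -mulr_sumr exchange_big /=; congr (_ * _).
  rewrite (bigD1 q) //= [X in _ + X]big1 ?addr0 => [|d dq].
    under eq_bigr do rewrite mulrAC.
    rewrite -mulr_suml.
    have -> : \sum_d invmx (G x) d q * G x d q = (G x *m invmx (G x)) q q.
      by rewrite mxE; apply: eq_bigr => d _; rewrite mulrC -{1}GT mxE.
    by rewrite mulmxV ?gram_unit// mxE eqxx mul1r.
  under eq_bigr do rewrite mulrAC.
  rewrite -mulr_suml.
  have -> : \sum_e invmx (G x) e d * G x e q = (G x *m invmx (G x)) q d.
    by rewrite mxE; apply: eq_bigr => e _; rewrite mulrC -{1}GT mxE.
  by rewrite mulmxV ?gram_unit// mxE eq_sym (negbTE dq) mul0r.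
rewrite /covd; set a := b ord0; set p := idx_tail b 0; set q := idx_tail b 1.
have tE : idx_tail b = idx2 p q.
  apply/ffunP => s; rewrite [RHS]ffunE; case: ifPn => [/eqP -> //|s0].
  by congr (idx_tail b _); apply/val_inj; case: s s0 => [[|[|]]].
have set0E d : idx_set (idx_tail b) 0 d = idx2 d q.
  by rewrite tE; apply/ffunP => s; rewrite !ffunE; case: eqP.
have set1E d : idx_set (idx_tail b) 1 d = idx2 p d.
  apply/ffunP => s; rewrite tE !ffunE.
  by case: s => [[|[|]]].
have GE y u v : g i y (idx2 u v) = G y u v by rewrite mxE.
rewrite big_ord_recl big_ord1 -/p.
have -> : lift ord0 ord0 = 1 :> 'I_2 by apply/val_inj.
rewrite -/q.
under eq_bigr do rewrite set0E GE.
under [X in _ - (_ + X)]eq_bigr do rewrite set1E GE -GT mxE.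
rewrite !low tE.
have -> : (fun y => g i y (idx2 p q)) = (fun y => G y p q) by apply/funext => y.
rewrite (pd_gramC p q a ix) (pd_gramC p a q ix) (pd_gramC q a p ix).
by rewrite -/G; field.
Qed.

End LeviCivitaMetric.

Section BoostOrder.
Variables (R : realType) (n : nat).
Implicit Types (G : 'M[R]_n) (L : set 'rV[R]_n) (e : 'I_n -> 'rV[R]_n).

Definition eval_tensor (r : nat) (T : tensor R n r) (v : 'I_r -> 'rV[R]_n) : R :=
  \sum_(b : {ffun 'I_r -> 'I_n}) T b * \prod_(s < r) v s 0 (b s).

(* (e 0, e 1, e i) = (k, l, m_i): the only non-zero inner products are
   g(k, l) = g(m_i, m_i) = 1. *)
Definition null_frame G L e : Prop :=
  (forall i : 'I_n, i = 0%N :> nat -> L (e i) /\ e i != 0) /\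
  (forall i j : 'I_n, inner G (e i) (e j) =
     (if (i < 2)%N && (j < 2)%N then i != j else i == j)%:R).

Definition boost_weight (r : nat) (al : 'I_r -> 'I_n) : int :=
  (#|[pred s | al s == 0%N :> nat]|)%:Z - (#|[pred s | al s == 1%N :> nat]|)%:Z.

(* The boost order of T is at most s; this includes T = 0. *)
Definition boost_order_le G L (r : nat) (T : tensor R n r) (s : int) : Prop :=
  forall e, null_frame G L e -> forall al : 'I_r -> 'I_n,
    eval_tensor T (e \o al) != 0 -> boost_weight al <= s.

Definition boost_order_eq G L (r : nat) (T : tensor R n r) (s : int) : Prop :=
  boost_order_le G L T s /\
  forall e, null_frame G L e -> exists al : 'I_r -> 'I_n,
    eval_tensor T (e \o al) != 0 /\ boost_weight al = s.

End BoostOrder.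

Section Congruences.
Variables (R : realType) (n : nat) (M : manifold R n) (g : lorentzian_metric M)
  (c : line_field M).

Definition nabla (r : nat) (T : chart_index M -> 'rV[R]_n -> tensor R n r) :
  chart_index M -> 'rV[R]_n -> tensor R n r.+1 :=
  fun i => covd (gram g i) (T i).

(* Boost order conditions along c are imposed at every point, computed in every
   chart around it. *)
Definition bo_le (r : nat) (T : chart_index M -> 'rV[R]_n -> tensor R n r)
    (s : int) : Prop :=
  forall i x, cod (atlas i) x ->
    boost_order_le (gram g i x) (fibre c i x) (T i x) s.

Definition bo_eq (r : nat) (T : chart_index M -> 'rV[R]_n -> tensor R n r)
    (s : int) : Prop :=
  forall i x, cod (atlas i) x ->
    boost_order_eq (gram g i x) (fibre c i x) (T i x) s.

Definition geodetic : Prop :=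
  forall i U k, local_section c i U k -> forall x, U x ->
    exists a : R, covd_vect (gram g i) k x (k x) = a *: k x.

(* The vectors X range over the orthogonal complement of the line of c. *)
Definition kundt : Prop :=
  forall i U k, local_section c i U k -> forall x, U x ->
    forall X : 'rV[R]_n,
      (forall v, fibre c i x v -> inner (gram g i x) X v = 0) ->
      exists a : R, covd_vect (gram g i) k x X = a *: k x.

End Congruences.

(* Main.v *)
From HB Require Import structures.
Require Import Defs.
From mathcomp Require Import all_boot all_order all_algebra perm.
From mathcomp Require Import all_classical all_reals topology normedtype derive.
From mathcomp Require Import ring lra.
Import Order.TTheory GRing.Theory Num.Theory.
Import numFieldNormedType.Exports.
Local Open Scope classical_set_scope.
Local Open Scope ring_scope.

(** Let k be a local section of c and K = g(k, .). That S is of type N along c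
    means that near each point S = f K K with f non-zero there (section_factor).
    Differentiate this product and evaluate the result at vectors: a factor K
    evaluated at v contributes nothing until it has been differentiated often
    enough for its value at v to be non-zero.

    At a pair (v, v) with v orthogonal to k both factors have to be
    differentiated, so two derivatives leave only
      nabla nabla S (X, X; v, v) = 2 f g(nabla_X k, v)^2.
    For X = k and v = m_j the boost weight is 2, so g(nabla_k k, m_j) = 0 for
    all transverse j (nabla2_transverse). Also g(nabla_k k, k) = 0 since k is
    null, and a vector orthogonal to k and to all m_j is a multiple of k
    (frame_null): c is geodetic.

    At a pair (k, w) with w orthogonal to k even the first derivative of the
    factor evaluated at k vanishes: (nabla_X K)(k) = g(nabla_X k, k) = 0. That
    factor takes two derivatives, and differentiating the last identity gives
    (nabla_X nabla_X K)(k) = - g(nabla_X k, nabla_X k) (Dcov2_null). Hence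
      nabla nabla nabla S (X, X, X; k, w)
        = - 3 f g(nabla_X k, nabla_X k) g(nabla_X k, w).
    For X = m_j and w = m_q the boost weight is 1, so the right-hand side
    vanishes for all q. As nabla_X k is orthogonal to k, its norm is the sum of
    the squares of its transverse components g(nabla_X k, m_q) (frame_norm), so
    all of these are zero (nabla3_transverse) and nabla_X k is a multiple of k.
    With the geodetic case and linearity in X this is the Kundt condition.

    Two points need care. The Christoffel terms that act on the derivative
    indices of nabla nabla S and nabla nabla nabla S involve derivatives of S
    of lower order, which vanish at the same arguments by the same count
    (nabla2_outer, nabla3_outer); so the computation can be made with the
    operators D_a that act on the two indices of S alone. And the boost order
    hypotheses speak about null frames, so a frame starting with k has to be
    produced: a Lorentz frame provides some null frame, and a reflection moves
    its first vector to k (null_frame_exists). *)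

Set Implicit Arguments.
Unset Strict Implicit.
Unset Printing Implicit Defensive.

(** * Smooth functions *)
Section Smooth.
Variables (R : realType) (n : nat) (U : set 'rV[R]_n).
Hypothesis Uo : open U.
Implicit Types (f g : 'rV[R]_n -> R) (a : 'I_n).

Lemma pd_near f g a x : U x -> (forall y, U y -> f y = g y) ->
  pd a f x = pd a g x.
Proof.
move=> Ux fg; apply: near_eq_derive.
by apply: filterS (open_nbhs_nbhs (conj Uo Ux)) => y Uy; exact: fg.
Qed.

(** Class C^m, with derivatives peeled off innermost first: unlike the iterated
    form of [smooth], this recursion lets closure properties go by induction on
    the order, the derivative of a product being a sum of products. *)
Fixpoint classC (m : nat) f : Prop :=
  (forall x, U x -> {for x, continuous f}) /\
  (if m is m'.+1 then
    forall a, (forall x, U x -> derivable f x (delta_mx 0 a)) /\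
      classC m' (pd a f)
   else True).

Lemma smoothP f : smooth U f <-> forall m, classC m f.
Proof.
split.
  move=> sf m; elim: m f sf => [|m IH] f sf /=.
    by split=> // x Ux; have [] := sf [::] x Ux.
  split=> [x Ux|a]; first by have [] := sf [::] x Ux.
  split=> [x Ux|]; first by have [] := sf [::] x Ux.
  apply: IH => s x Ux; have := sf (rcons s a) x Ux.
  by rewrite foldr_rcons.
move=> cf s; elim/last_ind: s f cf => [|s a IH] f cf x Ux /=.
  split; first by have [+ _] := cf 0%N; apply.
  by move=> a; have [_ /(_ a)[+ _]] := cf 1%N; apply.
rewrite foldr_rcons; apply: IH => // m.
by have [_ /(_ a)[_]] := cf m.+1.
Qed.

Lemma classCS m f : classC m.+1 f -> classC m f.
Proof.
elim: m f => [|m IH] f [fc fd]; first by split.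
by split=> // a; have [fa fb] := fd a; split=> //; exact: IH.
Qed.

Lemma continuous_near f g x : U x -> (forall y, U y -> f y = g y) ->
  {for x, continuous f} -> {for x, continuous g}.
Proof.
move=> Ux fg fc; have fgx : {near x, f =1 g}.
  by apply: filterS (open_nbhs_nbhs (conj Uo Ux)) => y Uy; exact: fg.
rewrite /prop_for /continuous_at -fg //; apply: cvg_trans fc.
exact: (@near_eq_cvg _ _ (nbhs x) _ f g fgx).
Qed.

Lemma eq_classC m f g : (forall x, U x -> f x = g x) -> classC m f -> classC m g.
Proof.
elim: m f g => [|m IH] f g fg [fc fd].
  by split=> // x Ux; exact: continuous_near fg (fc x Ux).
split=> [x Ux|a]; first exact: continuous_near fg (fc x Ux).
have [fa fb] := fd a; split=> [x Ux|].
  apply: near_eq_derivable (fa x Ux).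
  by apply: filterS (open_nbhs_nbhs (conj Uo Ux)) => y Uy; exact: fg.
by apply: IH fb => x Ux; apply: pd_near.
Qed.

Lemma classC_cst m (r : R) : classC m (fun=> r).
Proof.
elim: m r => [|m IH] r; first by split=> // x _; exact: cst_continuous.
split=> [x _|a]; first exact: cst_continuous.
split=> [x _|]; first exact: (derivable_cst r x (delta_mx 0 a)).
by apply: eq_classC (IH 0) => x _; rewrite /pd derive_cst.
Qed.

Lemma classCD m f g : classC m f -> classC m g -> classC m (fun x => f x + g x).
Proof.
elim: m f g => [|m IH] f g [fc fd] [gc gd].
  by split=> // x Ux; apply: continuousD; [exact: fc|exact: gc].
split=> [x Ux|a]; first by apply: continuousD; [exact: fc|exact: gc].
have [[fa fb] [ga gb]] := (fd a, gd a).
split=> [x Ux|]; first by apply: derivableD; [exact: fa|exact: ga].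
apply: eq_classC (IH _ _ fb gb) => x Ux.
by rewrite /pd -deriveD; [|exact: fa|exact: ga].
Qed.

Lemma pdM f g a x : derivable f x (delta_mx 0 a) ->
  derivable g x (delta_mx 0 a) ->
  pd a (fun y => f y * g y) x = pd a f x * g x + f x * pd a g x.
Proof.
by move=> fa ga; rewrite /pd [LHS](deriveM fa ga) /GRing.scale /= addrC mulrC.
Qed.

Lemma classCM m f g : classC m f -> classC m g -> classC m (fun x => f x * g x).
Proof.
elim: m f g => [|m IH] f g Cf Cg; move: (Cf) (Cg) => [fc fd] [gc gd].
  by split=> // x Ux; apply: continuousM; [exact: fc|exact: gc].
split=> [x Ux|a]; first by apply: continuousM; [exact: fc|exact: gc].
have [[fa fb] [ga gb]] := (fd a, gd a).
split=> [x Ux|]; first by apply: derivableM; [exact: fa|exact: ga].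
apply: eq_classC (classCD (IH _ _ fb (classCS Cg)) (IH _ _ (classCS Cf) gb)).
move=> x Ux.
by rewrite pdM; [|exact: fa|exact: ga].
Qed.

Lemma classCV m f : (forall x, U x -> f x != 0) -> classC m f ->
  classC m (fun x => (f x)^-1).
Proof.
move=> f0; elim: m f f0 => [|m IH] f f0 Cf; move: (Cf) => [fc fd].
  by split=> // x Ux; apply: continuousV; [exact: f0|exact: fc].
split=> [x Ux|a]; first by apply: continuousV; [exact: f0|exact: fc].
have [fa fb] := fd a.
split=> [x Ux|]; first by apply: derivableV; [exact: f0|exact: fa].
have CV := IH f f0 (classCS Cf).
apply: eq_classC (classCM (classC_cst m (-1)) (classCM (classCM CV CV) fb)).
move=> x Ux.
rewrite /pd deriveV; [|exact: f0|exact: fa].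
by rewrite /GRing.scale /= -exprVn expr2 mulN1r mulNr.
Qed.

Lemma eq_smooth f g : (forall x, U x -> f x = g x) -> smooth U f -> smooth U g.
Proof. by move=> fg /smoothP sf; apply/smoothP => m; apply: eq_classC (sf m). Qed.

Lemma smooth_cst (r : R) : smooth U (fun=> r).
Proof. by apply/smoothP => m; exact: classC_cst. Qed.

Lemma smoothD f g : smooth U f -> smooth U g -> smooth U (fun x => f x + g x).
Proof. by move=> /smoothP sf /smoothP sg; apply/smoothP => m; exact: classCD. Qed.

Lemma smoothM f g : smooth U f -> smooth U g -> smooth U (fun x => f x * g x).
Proof. by move=> /smoothP sf /smoothP sg; apply/smoothP => m; exact: classCM. Qed.

Lemma smoothV f : (forall x, U x -> f x != 0) -> smooth U f ->
  smooth U (fun x => (f x)^-1).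
Proof. by move=> f0 /smoothP sf; apply/smoothP => m; exact: classCV. Qed.

Lemma smoothN f : smooth U f -> smooth U (fun x => - f x).
Proof.
move=> sf; apply: eq_smooth (smoothM (smooth_cst (-1)) sf) => x _.
exact: mulN1r.
Qed.

Lemma smooth_sum (I : Type) (r : seq I) (F : I -> 'rV[R]_n -> R) :
  (forall i, smooth U (F i)) -> smooth U (fun x => \sum_(i <- r) F i x).
Proof.
move=> sF; elim: r => [|i r IH].
  by apply: eq_smooth (smooth_cst 0) => x _; rewrite big_nil.
by apply: eq_smooth (smoothD (sF i) IH) => x _; rewrite big_cons.
Qed.

Lemma smooth_prod (I : Type) (r : seq I) (F : I -> 'rV[R]_n -> R) :
  (forall i, smooth U (F i)) -> smooth U (fun x => \prod_(i <- r) F i x).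
Proof.
move=> sF; elim: r => [|i r IH].
  by apply: eq_smooth (smooth_cst 1) => x _; rewrite big_nil.
by apply: eq_smooth (smoothM (sF i) IH) => x _; rewrite big_cons.
Qed.

Lemma smooth_pd f a : smooth U f -> smooth U (pd a f).
Proof.
by move=> sf s x Ux; have := sf (rcons s a) x Ux; rewrite foldr_rcons.
Qed.

Lemma smooth_derivable f a x : smooth U f -> U x ->
  derivable f x (delta_mx 0 a).
Proof. by move=> sf Ux; have [_ /(_ a)] := sf [::] x Ux. Qed.

Lemma smooth_continuous f x : smooth U f -> U x -> {for x, continuous f}.
Proof. by move=> sf Ux; have [] := sf [::] x Ux. Qed.

Lemma smooth_pdD f g a x : U x -> smooth U f -> smooth U g ->
  pd a (fun y => f y + g y) x = pd a f x + pd a g x.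
Proof.
by move=> Ux sf sg; rewrite /pd -deriveD //; exact: smooth_derivable.
Qed.

Lemma smooth_pdM f g a x : U x -> smooth U f -> smooth U g ->
  pd a (fun y => f y * g y) x = pd a f x * g x + f x * pd a g x.
Proof. by move=> Ux sf sg; apply: pdM; exact: smooth_derivable. Qed.

Lemma smooth_pd_sum (I : Type) (r : seq I) (F : I -> 'rV[R]_n -> R) a x :
  U x -> (forall i, smooth U (F i)) ->
  pd a (fun y => \sum_(i <- r) F i y) x = \sum_(i <- r) pd a (F i) x.
Proof.
move=> Ux sF; elim: r => [|i r IH].
  rewrite big_nil; under eq_fun do rewrite big_nil.
  by rewrite /pd derive_cst.
rewrite big_cons -IH -smooth_pdD //; last exact: smooth_sum.
by congr (pd a _ x); apply/funext => y; rewrite big_cons.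
Qed.

End Smooth.

Lemma smooth_sub (R : realType) (n : nat) (U V : set 'rV[R]_n)
  (f : 'rV[R]_n -> R) : V `<=` U -> smooth U f -> smooth V f.
Proof. by move=> VU sf s x /VU; exact: sf. Qed.

(** * Matrix-valued functions *)

(** Locked, as are the operators built on it: unification then compares two
    applications by their arguments, never by unfolding them down to the
    limits that define derivatives. *)
HB.lock Definition pdm (R : realType) (n p q : nat) (a : 'I_n)
    (A : 'rV[R]_n -> 'M[R]_(p, q)) (x : 'rV[R]_n) : 'M[R]_(p, q) :=
  \matrix_(i, j) pd a (fun y => A y i j) x.

Section MatrixFields.
Variables (R : realType) (n : nat) (U : set 'rV[R]_n).
Hypothesis Uo : open U.

Definition smoothmx p q (A : 'rV[R]_n -> 'M[R]_(p, q)) : Prop :=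
  forall i j, smooth U (fun x => A x i j).

Lemma pdm_near p q a (A B : 'rV[R]_n -> 'M[R]_(p, q)) x : U x ->
  (forall y, U y -> A y = B y) -> pdm a A x = pdm a B x.
Proof.
move=> Ux AB; apply/matrixP => i j; rewrite pdm.unlock !mxE.
by apply: (pd_near Uo) => // y Uy; rewrite AB.
Qed.

Lemma eq_smoothmx p q (A B : 'rV[R]_n -> 'M[R]_(p, q)) :
  (forall x, U x -> A x = B x) -> smoothmx A -> smoothmx B.
Proof.
by move=> AB sA i j; apply: (eq_smooth Uo) (sA i j) => x Ux; rewrite AB.
Qed.

Lemma smoothmx_pdm p q a (A : 'rV[R]_n -> 'M[R]_(p, q)) :
  smoothmx A -> smoothmx (pdm a A).
Proof.
move=> sA i j; apply: (eq_smooth Uo) (smooth_pd a (sA i j)) => x Ux.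
by rewrite pdm.unlock mxE.
Qed.

Lemma smoothmxD p q (A B : 'rV[R]_n -> 'M[R]_(p, q)) :
  smoothmx A -> smoothmx B -> smoothmx (fun x => A x + B x).
Proof.
move=> sA sB i j; apply: (eq_smooth Uo) (smoothD Uo (sA i j) (sB i j)).
by move=> x _; rewrite mxE.
Qed.

Lemma smoothmxN p q (A : 'rV[R]_n -> 'M[R]_(p, q)) :
  smoothmx A -> smoothmx (fun x => - A x).
Proof.
move=> sA i j; apply: (eq_smooth Uo) (smoothN Uo (sA i j)).
by move=> x _; rewrite mxE.
Qed.

Lemma smoothmxZ p q f (A : 'rV[R]_n -> 'M[R]_(p, q)) :
  smooth U f -> smoothmx A -> smoothmx (fun x => f x *: A x).
Proof.
move=> sf sA i j; apply: (eq_smooth Uo) (smoothM Uo sf (sA i j)).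
by move=> x _; rewrite mxE.
Qed.

Lemma smoothmxT p q (A : 'rV[R]_n -> 'M[R]_(p, q)) :
  smoothmx A -> smoothmx (fun x => (A x)^T).
Proof.
by move=> sA i j; apply: (eq_smooth Uo) (sA j i) => x _; rewrite mxE.
Qed.

Lemma smoothmxM p q r (A : 'rV[R]_n -> 'M[R]_(p, q))
    (B : 'rV[R]_n -> 'M[R]_(q, r)) :
  smoothmx A -> smoothmx B -> smoothmx (fun x => A x *m B x).
Proof.
move=> sA sB i j.
apply: (eq_smooth Uo) (smooth_sum Uo _ (fun e => smoothM Uo (sA i e) (sB e j))).
by move=> x _; rewrite mxE.
Qed.

Lemma smoothmx_sum p q (I : Type) (s : seq I)
    (F : I -> 'rV[R]_n -> 'M[R]_(p, q)) :
  (forall i, smoothmx (F i)) -> smoothmx (fun x => \sum_(i <- s) F i x).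
Proof.
move=> sF i j; apply: (eq_smooth Uo) (smooth_sum Uo s (fun e => sF e i j)).
by move=> x _; rewrite summxE.
Qed.

Lemma pdmD p q a (A B : 'rV[R]_n -> 'M[R]_(p, q)) x : U x ->
  smoothmx A -> smoothmx B ->
  pdm a (fun y => A y + B y) x = pdm a A x + pdm a B x.
Proof.
move=> Ux sA sB; apply/matrixP => i j; rewrite pdm.unlock !mxE.
rewrite -(smooth_pdD a Ux (sA i j) (sB i j)).
by congr (pd a _ x); apply/funext => y; rewrite mxE.
Qed.

Lemma pdmZ p q a f (A : 'rV[R]_n -> 'M[R]_(p, q)) x : U x ->
  smooth U f -> smoothmx A ->
  pdm a (fun y => f y *: A y) x = pd a f x *: A x + f x *: pdm a A x.
Proof.
move=> Ux sf sA; apply/matrixP => i j; rewrite pdm.unlock !mxE.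
rewrite -(smooth_pdM a Ux sf (sA i j)).
by congr (pd a _ x); apply/funext => y; rewrite mxE.
Qed.

Lemma pdmT p q a (A : 'rV[R]_n -> 'M[R]_(p, q)) x :
  pdm a (fun y => (A y)^T) x = (pdm a A x)^T.
Proof.
apply/matrixP => i j; rewrite pdm.unlock !mxE.
by congr (pd a _ x); apply/funext => y; rewrite mxE.
Qed.

Lemma pdmM p q r a (A : 'rV[R]_n -> 'M[R]_(p, q))
    (B : 'rV[R]_n -> 'M[R]_(q, r)) x : U x -> smoothmx A -> smoothmx B ->
  pdm a (fun y => A y *m B y) x = pdm a A x *m B x + A x *m pdm a B x.
Proof.
move=> Ux sA sB; apply/matrixP => i j; rewrite pdm.unlock !mxE -big_split /=.
transitivity (pd a (fun y => \sum_e A y i e * B y e j) x).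
  by congr (pd a _ x); apply/funext => y; rewrite mxE.
rewrite (smooth_pd_sum Uo) => [|//|e]; last exact: smoothM.
by apply: eq_bigr => e _; rewrite !mxE (smooth_pdM _ Ux).
Qed.

Lemma smooth_det p (A : 'rV[R]_n -> 'M[R]_p) :
  smoothmx A -> smooth U (fun x => \det (A x)).
Proof.
move=> sA; apply: (smooth_sum Uo) => s; apply: (smoothM Uo).
  exact: smooth_cst.
exact: (smooth_prod Uo).
Qed.

(** The inverse is the adjugate divided by the determinant, both polynomial in
    the entries. *)
Lemma smoothmx_inv p (A : 'rV[R]_n -> 'M[R]_p) :
  (forall x, U x -> A x \in unitmx) -> smoothmx A ->
  smoothmx (fun x => invmx (A x)).
Proof.
move=> Au sA; apply: (@eq_smoothmx _ _ (fun x => (\det (A x))^-1 *: \adj (A x))).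
  by move=> x Ux; rewrite /invmx Au.
apply: smoothmxZ => [|i j].
  apply: (smoothV Uo) => [x Ux|]; last exact: smooth_det.
  by rewrite -unitfE -unitmxE Au.
apply: (eq_smooth Uo (f := fun x => cofactor (A x) j i)) => [x _|].
  by rewrite mxE.
apply: (smoothM Uo); first exact: smooth_cst.
apply: smooth_det => e e'.
by apply: (eq_smooth Uo) (sA (lift j e) (lift i e')) => x _; rewrite !mxE.
Qed.

End MatrixFields.

Lemma smoothmx_sub (R : realType) (n p q : nat) (U V : set 'rV[R]_n)
    (A : 'rV[R]_n -> 'M[R]_(p, q)) :
  V `<=` U -> smoothmx U A -> smoothmx V A.
Proof. by move=> VU sA i j; exact: smooth_sub (sA i j). Qed.

(** * The connection on bilinear forms, covectors and vectors *)

(** The upper index of the Christoffel symbol labels the columns, so that the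
    connection acts on vectors, which are rows, by right multiplication with
    [conn_mx], and on covectors by minus its transpose. *)
Definition conn_mx (R : realType) (n : nat) (G : 'rV[R]_n -> 'M[R]_n)
    (a : 'I_n) (x : 'rV[R]_n) : 'M[R]_n :=
  \matrix_(c, b) christoffel G x b a c.

(** Covariant derivative in the coordinate direction [a] acting on the two
    indices of [A] only. Iterates of [Dform] thus differ from iterated
    covariant derivatives by the Christoffel terms of the derivative indices;
    in exchange they obey a plain Leibniz rule. *)
HB.lock Definition Dform (R : realType) (n : nat) (G : 'rV[R]_n -> 'M[R]_n)
    (a : 'I_n) (A : 'rV[R]_n -> 'M[R]_n) (x : 'rV[R]_n) : 'M[R]_n :=
  pdm a A x - conn_mx G a x *m A x - A x *m (conn_mx G a x)^T.

HB.lock Definition Dcov (R : realType) (n : nat) (G : 'rV[R]_n -> 'M[R]_n)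
    (a : 'I_n) (K : 'rV[R]_n -> 'rV[R]_n) (x : 'rV[R]_n) : 'rV[R]_n :=
  pdm a K x - K x *m (conn_mx G a x)^T.

HB.lock Definition Dvec (R : realType) (n : nat) (G : 'rV[R]_n -> 'M[R]_n)
    (a : 'I_n) (k : 'rV[R]_n -> 'rV[R]_n) (x : 'rV[R]_n) : 'rV[R]_n :=
  pdm a k x + k x *m conn_mx G a x.

Section Connection.
Variables (R : realType) (n : nat) (U : set 'rV[R]_n).
Hypothesis Uo : open U.
Variable G : 'rV[R]_n -> 'M[R]_n.
Hypothesis sG : smoothmx U G.
Hypothesis Gu : forall x, U x -> G x \in unitmx.

Lemma smooth_christoffel a b c : smooth U (fun x => christoffel G x a b c).
Proof.
apply: (smoothM Uo) (smooth_cst Uo _) _; apply: (smooth_sum Uo) => d.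
apply: (smoothM Uo); first exact: (smoothmx_inv Uo Gu sG).
apply: (smoothD Uo); last by apply: (smoothN Uo); apply: smooth_pd.
by apply: (smoothD Uo); apply: smooth_pd.
Qed.

Lemma smoothmx_conn a : smoothmx U (conn_mx G a).
Proof.
move=> c b; apply: (eq_smooth Uo) (smooth_christoffel b a c) => x _.
by rewrite mxE.
Qed.

Local Notation conn_mx := (conn_mx G).
Local Notation Dform := (Dform G).
Local Notation Dcov := (Dcov G).
Local Notation Dvec := (Dvec G).

Lemma DformE a A x :
  Dform a A x = pdm a A x - conn_mx a x *m A x - A x *m (conn_mx a x)^T.
Proof. by rewrite Dform.unlock. Qed.

Lemma DcovE a K x : Dcov a K x = pdm a K x - K x *m (conn_mx a x)^T.
Proof. by rewrite Dcov.unlock. Qed.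

Lemma DvecE a k x : Dvec a k x = pdm a k x + k x *m conn_mx a x.
Proof. by rewrite Dvec.unlock. Qed.

Lemma smooth_Dform a A : smoothmx U A -> smoothmx U (Dform a A).
Proof.
move=> sA; have sC := smoothmx_conn a.
apply: (eq_smoothmx Uo (fun x _ => esym (DformE a A x))).
apply: (smoothmxD Uo); last first.
  exact: (smoothmxN Uo (smoothmxM Uo sA (smoothmxT Uo sC))).
apply: (smoothmxD Uo); first exact: smoothmx_pdm.
exact: (smoothmxN Uo (smoothmxM Uo sC sA)).
Qed.

Lemma smooth_Dcov a K : smoothmx U K -> smoothmx U (Dcov a K).
Proof.
move=> sK; apply: (eq_smoothmx Uo (fun x _ => esym (DcovE a K x))).
apply: (smoothmxD Uo); first exact: smoothmx_pdm.
exact: (smoothmxN Uo (smoothmxM Uo sK (smoothmxT Uo (smoothmx_conn a)))).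
Qed.

Lemma Dform_near a A B x : U x -> (forall y, U y -> A y = B y) ->
  Dform a A x = Dform a B x.
Proof. by move=> Ux AB; rewrite !DformE (pdm_near Uo a Ux AB) AB. Qed.

Lemma Dcov_near a K L x : U x -> (forall y, U y -> K y = L y) ->
  Dcov a K x = Dcov a L x.
Proof. by move=> Ux KL; rewrite !DcovE (pdm_near Uo a Ux KL) KL. Qed.

Lemma DformD a A B x : U x -> smoothmx U A -> smoothmx U B ->
  Dform a (fun y => A y + B y) x = Dform a A x + Dform a B x.
Proof.
move=> Ux sA sB; rewrite !DformE (pdmD _ Ux sA sB) mulmxDr mulmxDl 2!opprD.
by rewrite (addrACA (pdm a A x)) [LHS]addrACA.
Qed.

Lemma DformZ a f A x : U x -> smooth U f -> smoothmx U A ->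
  Dform a (fun y => f y *: A y) x = pd a f x *: A x + f x *: Dform a A x.
Proof.
move=> Ux sf sA; rewrite !DformE (pdmZ _ Ux sf sA) -scalemxAr -scalemxAl.
by rewrite !scalerBr !addrA.
Qed.

Lemma Dform_sum a (I : Type) (s : seq I) (F : I -> 'rV[R]_n -> 'M[R]_n) x :
  U x -> (forall i, smoothmx U (F i)) ->
  Dform a (fun y => \sum_(i <- s) F i y) x = \sum_(i <- s) Dform a (F i) x.
Proof.
move=> Ux sF; elim: s => [|i s IH].
  rewrite big_nil (_ : (fun y => _) = (fun=> 0)).
    rewrite !DformE mulmx0 mul0mx !subr0; apply/matrixP => i j.
    rewrite pdm.unlock [LHS]mxE [RHS]mxE.
    exact: (derive_cst ((0 : 'M[R]_n) i j)).
  by apply/funext => y; rewrite big_nil.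
rewrite big_cons -IH -(DformD a Ux (sF i) (smoothmx_sum Uo s sF)).
by apply: (Dform_near a Ux) => y _; rewrite big_cons.
Qed.

Lemma DcovD a K L x : U x -> smoothmx U K -> smoothmx U L ->
  Dcov a (fun y => K y + L y) x = Dcov a K x + Dcov a L x.
Proof.
by move=> Ux sK sL; rewrite !DcovE (pdmD _ Ux sK sL) mulmxDl opprD addrACA.
Qed.

Lemma DcovZ a f K x : U x -> smooth U f -> smoothmx U K ->
  Dcov a (fun y => f y *: K y) x = pd a f x *: K x + f x *: Dcov a K x.
Proof.
move=> Ux sf sK; rewrite !DcovE (pdmZ _ Ux sf sK) -scalemxAl.
by rewrite !scalerBr !addrA.
Qed.

Lemma Dform_outer a L K x : U x -> smoothmx U L -> smoothmx U K ->
  Dform a (fun y => (L y)^T *m K y) x =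
  (Dcov a L x)^T *m K x + (L x)^T *m Dcov a K x.
Proof.
move=> Ux sL sK; have sLT := smoothmxT Uo sL.
rewrite !DformE (pdmM Uo _ Ux sLT sK) (pdmT a L) !DcovE.
rewrite linearB /= mulmxBl mulmxBr trmx_mul trmxK !mulmxA.
by rewrite addrA; congr (_ - _); rewrite addrAC.
Qed.

End Connection.

(** * Pairings and inner products *)
Section Pairing.
Variables (R : realType) (n : nat).
Implicit Types (K L u v w : 'rV[R]_n) (A B : 'M[R]_n).

Definition pairing K v : R := (K *m v^T) 0 0.

Lemma pairingD K L v : pairing (K + L) v = pairing K v + pairing L v.
Proof. by rewrite /pairing mulmxDl mxE. Qed.

Lemma pairingZ (s : R) K v : pairing (s *: K) v = s * pairing K v.
Proof. by rewrite /pairing -scalemxAl mxE. Qed.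

Lemma pairingC K v : pairing K v = pairing v K.
Proof. by rewrite /pairing -[in LHS](trmxK K) -trmx_mul mxE. Qed.

Lemma pairing_mul A u v : pairing (u *m A) v = inner A u v.
Proof. by []. Qed.

Lemma inner_addmx A B u w : inner (A + B) u w = inner A u w + inner B u w.
Proof. by rewrite /inner mulmxDr mulmxDl mxE. Qed.

Lemma inner_oppmx A u w : inner (- A) u w = - inner A u w.
Proof. by rewrite /inner mulmxN mulNmx mxE. Qed.

Lemma inner_scalemx (s : R) A u w : inner (s *: A) u w = s * inner A u w.
Proof. by rewrite /inner -scalemxAr -scalemxAl mxE. Qed.

Lemma inner_summx (I : Type) (s : seq I) (F : I -> 'M[R]_n) u w :
  inner (\sum_(i <- s) F i) u w = \sum_(i <- s) inner (F i) u w.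
Proof.
elim: s => [|i s IH]; last by rewrite !big_cons inner_addmx IH.
by rewrite !big_nil /inner mulmx0 mul0mx mxE.
Qed.

Lemma inner_outer K L u w : inner (L^T *m K) u w = pairing L u * pairing K w.
Proof.
rewrite /inner /pairing mulmxA -mulmxA [u *m L^T]mx11_scalar mul_scalar_mx mxE.
by congr (_ * _); rewrite -/(pairing u L) pairingC.
Qed.

End Pairing.

Section Bilinear.
Variables (R : realType) (n : nat) (G : 'M[R]_n).
Hypothesis GT : G^T = G.
Implicit Types (u v w : 'rV[R]_n).

Lemma inner_sym u v : inner G u v = inner G v u.
Proof. by rewrite -!pairing_mul pairingC /pairing trmx_mul GT mulmxA. Qed.

Lemma innerDl u v w : inner G (u + v) w = inner G u w + inner G v w.
Proof. by rewrite -!pairing_mul mulmxDl pairingD. Qed.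

Lemma innerZl (s : R) v w : inner G (s *: v) w = s * inner G v w.
Proof. by rewrite -!pairing_mul -scalemxAl pairingZ. Qed.

Lemma innerDr u v w : inner G w (u + v) = inner G w u + inner G w v.
Proof. by rewrite !(inner_sym w) innerDl. Qed.

Lemma innerZr (s : R) v w : inner G w (s *: v) = s * inner G w v.
Proof. by rewrite !(inner_sym w) innerZl. Qed.

Lemma inner_suml (I : finType) (F : I -> 'rV[R]_n) w :
  inner G (\sum_i F i) w = \sum_i inner G (F i) w.
Proof.
elim/big_ind2: _ => [|u1 v1 u2 v2 <- <-|//]; last by rewrite innerDl.
by rewrite /inner !mul0mx mxE.
Qed.

Lemma inner_rows m (P : 'M[R]_(m, n)) i j :
  inner G (row i P) (row j P) = (P *m G *m P^T) i j.
Proof.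
rewrite /inner -row_mul mxE [RHS]mxE; apply: eq_bigr => l _.
congr (_ * _); first by rewrite mxE.
by rewrite !mxE.
Qed.

End Bilinear.

(** * Leibniz rule for a product of covectors *)

(** The matrices of nabla_b nabla_c S and nabla_a nabla_b nabla_c S, where A is
    the matrix of S: each sum corrects for one derivative index. See [mx_covd2]
    and [mx_covd3]. *)
HB.lock Definition nabla2 (R : realType) (n : nat) (G : 'rV[R]_n -> 'M[R]_n)
    (A : 'rV[R]_n -> 'M[R]_n) (b c : 'I_n) (x : 'rV[R]_n) : 'M[R]_n :=
  Dform G b (Dform G c A) x
  - \sum_d christoffel G x d b c *: Dform G d A x.

HB.lock Definition nabla3 (R : realType) (n : nat) (G : 'rV[R]_n -> 'M[R]_n)
    (A : 'rV[R]_n -> 'M[R]_n) (a b c : 'I_n) (x : 'rV[R]_n) : 'M[R]_n :=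
  Dform G a (nabla2 G A b c) x
  - \sum_d christoffel G x d a b *: nabla2 G A d c x
  - \sum_d christoffel G x d a c *: nabla2 G A b d x.

Section Leibniz.
Variables (R : realType) (n : nat) (U : set 'rV[R]_n).
Hypothesis Uo : open U.
Variable G : 'rV[R]_n -> 'M[R]_n.
Hypothesis sG : smoothmx U G.
Hypothesis Gu : forall x, U x -> G x \in unitmx.

Local Notation Dform := (Dform G).
Local Notation Dcov := (Dcov G).
Local Notation Dvec := (Dvec G).
Local Notation nabla2 := (nabla2 G).
Local Notation nabla3 := (nabla3 G).

Section Outer.
Variables (A : 'rV[R]_n -> 'M[R]_n) (L K : 'rV[R]_n -> 'rV[R]_n).
Hypotheses (sL : smoothmx U L) (sK : smoothmx U K).
Hypothesis AE : forall y, U y -> A y = (L y)^T *m K y.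

Let sDL a : smoothmx U (Dcov a L) := smooth_Dcov Uo sG Gu a sL.
Let sDK a : smoothmx U (Dcov a K) := smooth_Dcov Uo sG Gu a sK.

Lemma smoothmx_outer (P Q : 'rV[R]_n -> 'rV[R]_n) :
  smoothmx U P -> smoothmx U Q -> smoothmx U (fun y => (P y)^T *m Q y).
Proof. by move=> sP sQ; apply: (smoothmxM Uo) (smoothmxT Uo sP) sQ. Qed.

Lemma Dform_outer1 c y : U y ->
  Dform c A y = (Dcov c L y)^T *m K y + (L y)^T *m Dcov c K y.
Proof.
by move=> Uy; rewrite (Dform_near Uo G c Uy AE) (Dform_outer Uo G c Uy sL sK).
Qed.

Lemma Dform_outer2 b c y : U y -> Dform b (Dform c A) y =
  ((Dcov b (Dcov c L) y)^T *m K y + (Dcov c L y)^T *m Dcov b K y)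
  + ((Dcov b L y)^T *m Dcov c K y + (L y)^T *m Dcov b (Dcov c K) y).
Proof.
move=> Uy; rewrite (Dform_near Uo G b Uy (@Dform_outer1 c)).
rewrite (DformD G b Uy (smoothmx_outer (sDL c) sK) (smoothmx_outer sL (sDK c))).
rewrite (Dform_outer Uo G b Uy (sDL c) sK).
by rewrite (Dform_outer Uo G b Uy sL (sDK c)).
Qed.

Let sA : smoothmx U A.
Proof.
by apply: (eq_smoothmx Uo) (smoothmx_outer sL sK) => y Uy; rewrite AE.
Qed.
Let sDA c : smoothmx U (Dform c A) := smooth_Dform Uo sG Gu c sA.
Let sDDA b c : smoothmx U (Dform b (Dform c A)) :=
  smooth_Dform Uo sG Gu b (sDA c).

Variables (x u w : 'rV[R]_n).
Hypotheses (Ux : U x) (Lu : pairing (L x) u = 0) (Kw : pairing (K x) w = 0).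

(** A single derivative cannot reach both factors. *)
Lemma inner_Dform_outer c : inner (Dform c A x) u w = 0.
Proof.
rewrite (Dform_outer1 c Ux) inner_addmx !inner_outer Kw Lu.
by rewrite mulr0 mul0r addr0.
Qed.

Lemma inner_Dform2_outer b c : inner (Dform b (Dform c A) x) u w =
  pairing (Dcov c L x) u * pairing (Dcov b K x) w
  + pairing (Dcov b L x) u * pairing (Dcov c K x) w.
Proof.
rewrite (Dform_outer2 b c Ux) !inner_addmx !inner_outer Kw Lu.
by rewrite mulr0 mul0r add0r addr0.
Qed.

(** Each factor must receive one of the two derivatives; the correction terms
    carry one derivative only. *)
Lemma nabla2_outer b c : inner (nabla2 A b c x) u w =
  pairing (Dcov c L x) u * pairing (Dcov b K x) w
  + pairing (Dcov b L x) u * pairing (Dcov c K x) w.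
Proof.
rewrite nabla2.unlock inner_addmx inner_oppmx inner_summx inner_Dform2_outer.
rewrite big1 ?subr0 // => d _.
by rewrite inner_scalemx inner_Dform_outer mulr0.
Qed.

Hypothesis DLu : forall a, pairing (Dcov a L x) u = 0.

(** The factor evaluated at [u] needs two of the three derivatives. In all
    correction terms at most two derivatives act on the product, so one of the
    factors keeps vanishing. *)
Lemma nabla3_outer a b c : inner (nabla3 A a b c x) u w =
  pairing (Dcov b (Dcov c L) x) u * pairing (Dcov a K x) w
  + pairing (Dcov a (Dcov c L) x) u * pairing (Dcov b K x) w
  + pairing (Dcov a (Dcov b L) x) u * pairing (Dcov c K x) w.
Proof.
have nabla2_0 d e : inner (nabla2 A d e x) u w = 0.
  by rewrite nabla2_outer !DLu !mul0r addr0.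
have Dnabla2 : inner (Dform a (nabla2 A b c) x) u w =
    inner (Dform a (Dform b (Dform c A)) x) u w.
  (* Differentiating a correction term also differentiates its Christoffel
     symbol, which only multiplies first derivatives of A. *)
  pose E d y := (- christoffel G y d b c) *: Dform d A y.
  have sC d : smooth U (fun y => - christoffel G y d b c).
    by apply: (smoothN Uo); exact: smooth_christoffel.
  have sE d : smoothmx U (E d) by exact: (smoothmxZ Uo (sC d) (sDA d)).
  rewrite (Dform_near Uo G a Ux (B := fun y =>
      Dform b (Dform c A) y + \sum_d E d y)); last first.
    move=> y _; rewrite nabla2.unlock -sumrN; congr (_ + _).
    by apply: eq_bigr => d _; rewrite /E scaleNr.
  rewrite (DformD G a Ux (sDDA b c) (smoothmx_sum Uo _ sE)).
  rewrite inner_addmx (Dform_sum Uo G a _ Ux sE) inner_summx.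
  rewrite big1 ?addr0 // => d _.
  rewrite (DformZ G a Ux (sC d) (sDA d)) inner_addmx !inner_scalemx.
  rewrite inner_Dform_outer inner_Dform2_outer.
  by rewrite !DLu !mul0r addr0 !mulr0 addr0.
rewrite nabla3.unlock !inner_addmx !inner_oppmx !inner_summx Dnabla2.
rewrite !big1 ?subr0 => [|d _|d _]; try by rewrite inner_scalemx nabla2_0 mulr0.
rewrite (Dform_near Uo G a Ux (@Dform_outer2 b c)).
have s1 := smoothmx_outer (smooth_Dcov Uo sG Gu b (sDL c)) sK.
have s2 := smoothmx_outer (sDL c) (sDK b).
have s3 := smoothmx_outer (sDL b) (sDK c).
have s4 := smoothmx_outer sL (smooth_Dcov Uo sG Gu b (sDK c)).
rewrite (DformD G a Ux (smoothmxD Uo s1 s2) (smoothmxD Uo s3 s4)).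
rewrite (DformD G a Ux s1 s2) (DformD G a Ux s3 s4).
rewrite (Dform_outer Uo G a Ux (smooth_Dcov Uo sG Gu b (sDL c)) sK).
rewrite (Dform_outer Uo G a Ux (sDL c) (sDK b)).
rewrite (Dform_outer Uo G a Ux (sDL b) (sDK c)).
rewrite (Dform_outer Uo G a Ux sL (smooth_Dcov Uo sG Gu b (sDK c))).
by rewrite !inner_addmx !inner_outer Kw Lu !DLu !mulr0 !mul0r !add0r !addr0.
Qed.

End Outer.

(** ** The case of a null covector *)
Section RankOne.
Variables (k : 'rV[R]_n -> 'rV[R]_n) (f : 'rV[R]_n -> R).
Hypotheses (sk : smoothmx U k) (sf : smooth U f).
Hypothesis GT : forall y, U y -> (G y)^T = G y.
Hypothesis DG : forall a y, U y -> Dform a G y = 0.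
Hypothesis k0 : forall y, U y -> inner (G y) (k y) (k y) = 0.

Local Notation K := (fun y => k y *m G y).

Let sK : smoothmx U K := smoothmxM Uo sk sG.

(** The metric is parallel, so it commutes with differentiation. *)
Lemma Dcov_lower a y : U y -> Dcov a K y = Dvec a k y *m G y.
Proof.
move=> Uy; have := DG a Uy; rewrite DformE => /eqP.
rewrite subr_eq0 subr_eq => /eqP dG.
rewrite DcovE (pdmM Uo a Uy sk sG) dG DvecE mulmxDl mulmxDr !mulmxA.
by rewrite [_ *m _ *m _^T + _]addrC addrA addrK.
Qed.

Lemma Dcov_lower_pairing a y v : U y ->
  pairing (Dcov a K y) v = inner (G y) (Dvec a k y) v.
Proof. by move=> Uy; rewrite Dcov_lower. Qed.

Lemma pd_pairing a P v y : U y -> smoothmx U P -> smoothmx U v ->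
  pd a (fun z => pairing (P z) (v z)) y =
  pairing (Dcov a P y) (v y) + pairing (P y) (Dvec a v y).
Proof.
move=> Uy sP sv.
transitivity (pdm a (fun z => P z *m (v z)^T) y 0 0).
  by rewrite pdm.unlock mxE.
rewrite (pdmM Uo a Uy sP (smoothmxT Uo sv)) pdmT DcovE DvecE /pairing.
have mxD (B C : 'M[R]_1) : B 0 0 + C 0 0 = (B + C) 0 0 by rewrite mxE.
rewrite mulmxBl linearD /= mulmxDr trmx_mul mulmxA mxD.
by rewrite [X in _ - _ + X]addrC addrA subrK.
Qed.

(** Differentiate g(k, k) = 0. *)
Lemma Dvec_null a y : U y -> inner (G y) (Dvec a k y) (k y) = 0.
Proof.
move=> Uy; have : pd a (fun z => pairing (K z) (k z)) y = 0.
  rewrite (pd_near Uo (g := fun=> 0) a Uy); last exact: k0.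
  exact: derive_cst.
rewrite (pd_pairing a Uy sK sk) (Dcov_lower_pairing _ _ Uy) pairing_mul.
by rewrite (inner_sym (GT Uy) (k y)) -mulr2n => /eqP; rewrite mulrn_eq0 => /eqP.
Qed.

Lemma Dcov_null a y : U y -> pairing (Dcov a K y) (k y) = 0.
Proof. by move=> Uy; rewrite Dcov_lower_pairing // Dvec_null. Qed.

(** Differentiate (D_b K)(k) = 0. *)
Lemma Dcov2_null a b y : U y ->
  pairing (Dcov a (Dcov b K) y) (k y) = - inner (G y) (Dvec a k y) (Dvec b k y).
Proof.
move=> Uy; have : pd a (fun z => pairing (Dcov b K z) (k z)) y = 0.
  rewrite (pd_near Uo (g := fun=> 0) a Uy); last by move=> z; exact: Dcov_null.
  exact: derive_cst.
rewrite (pd_pairing a Uy (smooth_Dcov Uo sG Gu b sK) sk).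
rewrite (Dcov_lower_pairing _ _ Uy) (inner_sym (GT Uy) (Dvec b k y)) => /eqP.
by rewrite addr_eq0 => /eqP.
Qed.

Local Notation L := (fun y => f y *: K y).
Let sL : smoothmx U L := smoothmxZ Uo sf sK.

Variable A : 'rV[R]_n -> 'M[R]_n.
Hypothesis AE : forall y, U y -> A y = f y *: ((K y)^T *m K y).

Let AE' y : U y -> A y = (L y)^T *m K y.
Proof. by move=> Uy; rewrite AE // linearZ /= scalemxAl. Qed.

Let DL a y : U y -> Dcov a L y = pd a f y *: K y + f y *: Dcov a K y.
Proof. by move=> Uy; rewrite (DcovZ G a Uy sf sK). Qed.

(* Where K vanishes, the derivatives of the scalar factor drop out. *)
Let DLv a y v : U y -> pairing (K y) v = 0 ->
  pairing (Dcov a L y) v = f y * pairing (Dcov a K y) v.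
Proof. by move=> Uy Kv; rewrite DL // pairingD !pairingZ Kv mulr0 add0r. Qed.

Lemma nabla2_rank1 b c x v w : U x ->
  inner (G x) (k x) v = 0 -> inner (G x) (k x) w = 0 ->
  inner (nabla2 A b c x) v w =
  f x * (inner (G x) (Dvec b k x) v * inner (G x) (Dvec c k x) w
         + inner (G x) (Dvec c k x) v * inner (G x) (Dvec b k x) w).
Proof.
move=> Ux Kv Kw; rewrite -!pairing_mul in Kv Kw.
have Lv : pairing (L x) v = 0 by rewrite pairingZ Kv mulr0.
rewrite (nabla2_outer sL sK AE' Ux Lv Kw).
rewrite !(DLv _ Ux Kv) !(Dcov_lower_pairing _ _ Ux).
by rewrite -!mulrA -mulrDr addrC.
Qed.

Lemma nabla3_rank1 a b c x w : U x -> inner (G x) (k x) w = 0 ->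
  inner (nabla3 A a b c x) (k x) w = - f x *
    (inner (G x) (Dvec b k x) (Dvec c k x) * inner (G x) (Dvec a k x) w
   + inner (G x) (Dvec a k x) (Dvec c k x) * inner (G x) (Dvec b k x) w
   + inner (G x) (Dvec a k x) (Dvec b k x) * inner (G x) (Dvec c k x) w).
Proof.
move=> Ux Kw; rewrite -!pairing_mul in Kw.
have Kk : pairing (K x) (k x) = 0 by exact: k0.
have Lk : pairing (L x) (k x) = 0 by rewrite pairingZ Kk mulr0.
have DKk e : pairing (Dcov e K x) (k x) = 0 by exact: Dcov_null.
have DLk e : pairing (Dcov e L x) (k x) = 0 by rewrite DLv // DKk mulr0.
have DDL d e : pairing (Dcov d (Dcov e L) x) (k x) =
    - f x * inner (G x) (Dvec d k x) (Dvec e k x).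
  have s1 := smooth_Dcov Uo sG Gu e sK.
  rewrite (Dcov_near Uo G d Ux (@DL e)).
  rewrite (DcovD G d Ux (smoothmxZ Uo (smooth_pd e sf) sK) (smoothmxZ Uo sf s1)).
  rewrite (DcovZ G d Ux (smooth_pd e sf) sK) (DcovZ G d Ux sf s1).
  rewrite !pairingD !pairingZ Kk !DKk !mulr0 !add0r.
  by rewrite (Dcov2_null _ _ Ux) mulrN mulNr.
rewrite (nabla3_outer sL sK AE' Ux Lk Kw DLk) !DDL !(Dcov_lower_pairing _ _ Ux).
by rewrite -!mulrA -!mulrDr.
Qed.

End RankOne.

End Leibniz.

(** * Slicing tensors by their first indices *)
Section Slices.
Variables (R : realType) (n : nat).

Definition idx_cons (r : nat) (a : 'I_n) (b : {ffun 'I_r -> 'I_n}) :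
    {ffun 'I_r.+1 -> 'I_n} :=
  [ffun s => if unlift ord0 s is Some t then b t else a].

Definition slice (r : nat) (a : 'I_n) (T : tensor R n r.+1) : tensor R n r :=
  fun b => T (idx_cons a b).

Lemma idx_cons0 r a (b : {ffun 'I_r -> 'I_n}) : idx_cons a b ord0 = a.
Proof. by rewrite ffunE unlift_none. Qed.

Lemma idx_consS r a (b : {ffun 'I_r -> 'I_n}) s : idx_cons a b (lift ord0 s) = b s.
Proof. by rewrite ffunE liftK. Qed.

Lemma idx_cons_tail r (b : {ffun 'I_r.+1 -> 'I_n}) :
  idx_cons (b ord0) (idx_tail b) = b.
Proof.
apply/ffunP => s; case: (unliftP ord0 s) => [t|] ->; last by rewrite idx_cons0.
by rewrite idx_consS ffunE.
Qed.

Lemma idx_tail_cons r a (b : {ffun 'I_r -> 'I_n}) : idx_tail (idx_cons a b) = b.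
Proof. by apply/ffunP => s; rewrite ffunE idx_consS. Qed.

Lemma idx_set_cons0 r a (b : {ffun 'I_r -> 'I_n}) d :
  idx_set (idx_cons a b) ord0 d = idx_cons d b.
Proof.
apply/ffunP => s; rewrite [LHS]ffunE.
by case: (unliftP ord0 s) => [t|] ->; rewrite ?idx_cons0 ?idx_consS.
Qed.

Lemma idx_set_consS r a (b : {ffun 'I_r -> 'I_n}) s d :
  idx_set (idx_cons a b) (lift ord0 s) d = idx_cons a (idx_set b s d).
Proof.
apply/ffunP => t; rewrite [LHS]ffunE.
case: (unliftP ord0 t) => [u|] ->; rewrite ?idx_cons0 ?idx_consS //.
by rewrite (inj_eq lift_inj) [RHS]ffunE.
Qed.

Lemma sum_idx_cons (r : nat) (F : {ffun 'I_r.+1 -> 'I_n} -> R) :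
  \sum_b F b = \sum_a \sum_b F (idx_cons a b).
Proof.
rewrite pair_big /=.
rewrite (reindex (fun p : 'I_n * {ffun 'I_r -> 'I_n} => idx_cons p.1 p.2)) //=.
exists (fun b : {ffun 'I_r.+1 -> 'I_n} => (b ord0, idx_tail b)) => [[a b] _|b _] /=.
  by rewrite idx_cons0 idx_tail_cons.
exact: idx_cons_tail.
Qed.

Lemma eval_tensorS r (T : tensor R n r.+1) (v : 'I_r.+1 -> 'rV[R]_n) :
  eval_tensor T v =
  \sum_a v ord0 0 a * eval_tensor (slice a T) (fun s => v (lift ord0 s)).
Proof.
rewrite /eval_tensor sum_idx_cons; apply: eq_bigr => a _.
rewrite mulr_sumr; apply: eq_bigr => b _.
rewrite big_ord_recl idx_cons0 mulrCA; congr (_ * _); congr (_ * _).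
by apply: eq_bigr => s _; rewrite idx_consS.
Qed.

Lemma eval_tensor0 (T : tensor R n 0) (v : 'I_0 -> 'rV[R]_n) b :
  eval_tensor T v = T b.
Proof.
rewrite /eval_tensor (bigD1 b) //= big_ord0 mulr1 big1 ?addr0 // => c /eqP[].
by apply/ffunP => -[].
Qed.

Lemma eval_tensor2 (T : tensor R n 2) (v : 'I_2 -> 'rV[R]_n) :
  eval_tensor T v = inner (mx_of_tensor T) (v ord0) (v ord_max).
Proof.
have z : {ffun 'I_0 -> 'I_n} by apply: finfun => -[].
have l1 : lift ord0 ord0 = ord_max :> 'I_2 by apply/val_inj.
rewrite eval_tensorS /inner -mulmxA mxE; apply: eq_bigr => a _.
rewrite eval_tensorS l1 mxE; congr (_ * _); apply: eq_bigr => b _.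
rewrite (eval_tensor0 _ _ z) /slice !mxE mulrC; congr (T _ * _).
apply/ffunP => s; rewrite [RHS]ffunE; case: (unliftP ord0 s) => [t|] ->.
  by rewrite idx_consS [t]ord1 idx_cons0.
by rewrite idx_cons0.
Qed.

End Slices.

(** * Components of iterated covariant derivatives *)
Section CovariantDerivative.
Variables (R : realType) (n : nat) (G : 'rV[R]_n -> 'M[R]_n).

Definition Dten r (a : 'I_n) (T : 'rV[R]_n -> tensor R n r) x : tensor R n r :=
  fun b => pd a (fun y => T y b) x
    - \sum_(s < r) \sum_d christoffel G x d a (b s) * T x (idx_set b s d).

Lemma slice_covd r (T : 'rV[R]_n -> tensor R n r) a x :
  slice a (covd G T x) = Dten a T x.
Proof. by apply/funext => b; rewrite /slice /covd idx_cons0 idx_tail_cons. Qed.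

(** The index [c] that is frozen by the slice is one on which the connection
    acts; splitting off its Christoffel term leaves an operator on the
    remaining indices. *)
Lemma slice_Dten r (T : 'rV[R]_n -> tensor R n r.+1) a c x b :
  slice c (Dten a T x) b = Dten a (fun y => slice c (T y)) x b
    - \sum_d christoffel G x d a c * slice d (T x) b.
Proof.
rewrite /slice /Dten big_ord_recl idx_cons0 opprD addrA addrAC; congr (_ - _ - _).
  apply: eq_bigr => s _; apply: eq_bigr => d _.
  by rewrite idx_consS idx_set_consS.
by apply: eq_bigr => d _; rewrite idx_set_cons0.
Qed.

Lemma mx_Dten (T : 'rV[R]_n -> tensor R n 2) a x :
  mx_of_tensor (Dten a T x) = Dform G a (fun y => mx_of_tensor (T y)) x.
Proof.
rewrite DformE pdm.unlock; apply/matrixP => p q; rewrite !mxE.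
have l1 : lift ord0 ord0 = ord_max :> 'I_2 by apply/val_inj.
rewrite /Dten big_ord_recl big_ord1 l1 !ffunE /= opprD addrA.
congr (_ - _ - _).
- by congr (pd a _ x); apply/funext => y; rewrite mxE.
- apply: eq_bigr => d _; rewrite !mxE; congr (_ * T x _).
  by apply/ffunP => s; rewrite !ffunE; case: eqP.
- apply: eq_bigr => d _; rewrite !mxE mulrC; congr (T x _ * _).
  apply/ffunP => s; rewrite !ffunE.
  by case: (unliftP ord0 s) => [t|] ->; rewrite ?[t]ord1.
Qed.

Variable S : 'rV[R]_n -> tensor R n 2.
Let A y := mx_of_tensor (S y).

Lemma mx_covd1 c x :
  mx_of_tensor (slice c (covd G S x)) = Dform G c A x.
Proof. by rewrite slice_covd mx_Dten. Qed.

Lemma mx_slice_Dten (T : 'rV[R]_n -> tensor R n 3) a c x :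
  mx_of_tensor (slice c (Dten a T x)) =
  Dform G a (fun y => mx_of_tensor (slice c (T y))) x
  - \sum_d christoffel G x d a c *: mx_of_tensor (slice d (T x)).
Proof.
rewrite -mx_Dten; apply/matrixP => p q.
rewrite [LHS]mxE [RHS]mxE [X in _ = X + _]mxE slice_Dten; congr (_ + _).
rewrite [RHS]mxE summxE; congr (- _).
by apply: eq_bigr => d _; rewrite !mxE.
Qed.

Lemma mx_covd2 b c x :
  mx_of_tensor (slice c (slice b (covd G (covd G S) x))) = nabla2 G A b c x.
Proof.
rewrite slice_covd mx_slice_Dten nabla2.unlock.
rewrite (_ : (fun y => _) = Dform G c A); last first.
  by apply/funext => y; rewrite mx_covd1.
by congr (_ - _); apply: eq_bigr => d _; rewrite mx_covd1.
Qed.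

Lemma mx_covd3 a b c x :
  mx_of_tensor (slice c (slice b (slice a (covd G (covd G (covd G S)) x)))) =
  nabla3 G A a b c x.
Proof.
rewrite slice_covd nabla3.unlock.
set T := covd G (covd G S).
have -> : slice b (Dten a T x) =
    (fun e => Dten a (fun y => slice b (T y)) x e
      - \sum_d christoffel G x d a b * slice d (T x) e).
  by apply/funext => e; rewrite slice_Dten.
transitivity (mx_of_tensor (slice c (Dten a (fun y => slice b (T y)) x))
    - \sum_d christoffel G x d a b *: mx_of_tensor (slice c (slice d (T x)))).
  apply/matrixP => p q; rewrite !mxE summxE; congr (_ - _).
  by apply: eq_bigr => d _; rewrite !mxE.
rewrite mx_slice_Dten addrAC.
rewrite (_ : (fun y => _) = nabla2 G A b c); last first.
  by apply/funext => y; rewrite mx_covd2.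
congr (_ - _ - _); apply: eq_bigr => d _; by rewrite mx_covd2.
Qed.

Lemma eval_covd2 x (v : 'I_4 -> 'rV[R]_n) :
  eval_tensor (covd G (covd G S) x) v =
  \sum_b \sum_c v ord0 0 b * v (inord 1) 0 c *
    inner (nabla2 G A b c x) (v (inord 2)) (v (inord 3)).
Proof.
rewrite eval_tensorS; apply: eq_bigr => b _.
rewrite eval_tensorS mulr_sumr; apply: eq_bigr => c _.
rewrite eval_tensor2 mx_covd2 mulrA.
congr (_ * v _ 0 c * inner _ (v _) (v _)); apply/val_inj; by rewrite /= inordK.
Qed.

Lemma eval_covd3 x (v : 'I_5 -> 'rV[R]_n) :
  eval_tensor (covd G (covd G (covd G S)) x) v =
  \sum_a \sum_b \sum_c v ord0 0 a * v (inord 1) 0 b * v (inord 2) 0 c *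
    inner (nabla3 G A a b c x) (v (inord 3)) (v (inord 4)).
Proof.
rewrite eval_tensorS; apply: eq_bigr => a _.
rewrite eval_tensorS mulr_sumr; apply: eq_bigr => b _.
rewrite eval_tensorS !mulr_sumr; apply: eq_bigr => c _.
rewrite eval_tensor2 mx_covd3 !mulrA.
congr (_ * v _ 0 b * v _ 0 c * inner _ (v _) (v _)); apply/val_inj;
  by rewrite /= inordK.
Qed.

End CovariantDerivative.

(** * Null frames *)
Section Frames.
Variables (R : realType) (n : nat) (G : 'M[R]_n) (i0 i1 : 'I_n).
Hypothesis GT : G^T = G.
Hypotheses (i0E : i0 = 0%N :> nat) (i1E : i1 = 1%N :> nat).
Local Notation tau := (tperm i0 i1).

(** The Gram matrix of a null frame is the permutation matrix of the
    transposition of the first two indices. *)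
Definition null_gram (e : 'I_n -> 'rV[R]_n) : Prop :=
  forall i j, inner G (e i) (e j) = (i == tau j)%:R.

Let ieq0 (i : 'I_n) : (i == 0%N :> nat) = (i == i0).
Proof. by rewrite -val_eqE /= i0E. Qed.

Let ieq1 (i : 'I_n) : (i == 1%N :> nat) = (i == i1).
Proof. by rewrite -val_eqE /= i1E. Qed.

Let i01 : (i0 == i1) = false.
Proof. by rewrite -val_eqE /= i0E i1E. Qed.

Let ilt2 (i : 'I_n) : (i < 2)%N = (i == i0) || (i == i1).
Proof. by rewrite -ieq0 -ieq1; case: i => [[|[|]]]. Qed.

Lemma null_frameP L e : null_frame G L e <->
  [/\ L (e i0), e i0 != 0 & null_gram e].
Proof.
have E (i j : 'I_n) : (if (i < 2)%N && (j < 2)%N then i != j else i == j) =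
    (i == tau j).
  rewrite !ilt2; case: tpermP => [->|->|/eqP jn0 /eqP jn1].
  - rewrite eqxx andbT; have [->|_] := eqVneq i i0; first by rewrite i01.
    by have [] := eqVneq i i1.
  - rewrite eqxx orbT andbT; have [->|_] := eqVneq i i1.
      by rewrite orbT eq_sym i01.
    by rewrite orbF; have [] := eqVneq i i0.
  - by rewrite (negbTE jn0) (negbTE jn1) andbF.
split=> [[e0 eg]|[Le e0 eg]].
  by have [] := e0 i0 i0E; split=> // i j; rewrite eg E.
split=> [i /eqP|i j]; first by rewrite ieq0 => /eqP ->.
by rewrite eg E.
Qed.

Section FrameExpansion.
Variable e : 'I_n -> 'rV[R]_n.
Hypothesis eg : null_gram e.
Let E : 'M[R]_n := \matrix_i e i.

Let frame_gram : E *m G *m E^T = perm_mx tau.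
Proof.
apply/matrixP => i j; rewrite -inner_rows !rowK eg !mxE.
by congr (_%:R); rewrite -(inj_eq (@perm_inj _ tau)) tpermK.
Qed.

Let frame_inv : G *m E^T *m perm_mx tau *m E = 1%:M.
Proof.
apply: mulmx1C; rewrite !mulmxA frame_gram -perm_mxM.
by rewrite tperm2 perm_mx1.
Qed.

(** The dual basis of a null frame is the frame itself with its first two
    vectors exchanged. *)
Lemma frame_expand v : v = \sum_i inner G v (e (tau i)) *: e i.
Proof.
rewrite -{1}[v]mulmx1 -frame_inv !mulmxA mulmx_sum_row.
apply: eq_bigr => i _; rewrite rowK; congr (_ *: _).
rewrite mxE (bigD1 (tau i)) //= big1 => [|j ji].
  rewrite addr0 !mxE tpermK eqxx mulr1 /inner mxE.
  by apply: eq_bigr => j _; rewrite !mxE.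
rewrite [perm_mx _ _ _]mxE [1%:M _ _]mxE; case: eqP => [tj|]; last by rewrite mulr0.
by rewrite -tj tpermK eqxx in ji.
Qed.

Lemma frame_null v : (forall j, j != i1 -> inner G v (e j) = 0) ->
  v = inner G v (e i1) *: e i0.
Proof.
move=> v0; rewrite {1}[v]frame_expand (bigD1 i0) //= tpermL big1 ?addr0 //.
move=> i ii0; rewrite v0 ?scale0r //.
by rewrite -[X in _ != X](tpermL i0 i1) (inj_eq perm_inj).
Qed.

Lemma frame_perp v : inner G v (e i0) = 0 ->
  v = \sum_(i | i != i1) inner G v (e (tau i)) *: e i.
Proof.
move=> v0; rewrite {1}[v]frame_expand (bigD1 i1) //= tpermR v0.
by rewrite scale0r add0r.
Qed.

(** The coefficient along [e i1] is zero, and the one along [e i0] pairs only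
    with it: the transverse part, which is positive definite, remains. *)
Lemma frame_norm v : inner G v (e i0) = 0 ->
  inner G v v = \sum_(i | (i != i0) && (i != i1)) inner G v (e i) ^+ 2.
Proof.
move=> v0; rewrite {1}[v]frame_expand inner_suml (bigD1 i0) //= innerZl.
rewrite [inner _ (e i0) _](inner_sym GT) v0 mulr0 add0r.
rewrite (bigD1 i1) ?(eq_sym i1) ?i01 //= innerZl tpermR v0 mul0r add0r.
apply: eq_bigr => i /andP[ii0 ii1].
by rewrite innerZl tpermD 1?eq_sym // [inner _ (e i) _](inner_sym GT) expr2.
Qed.

Lemma frame_eqmx (A B : 'M[R]_n) :
  (forall i j, inner A (e i) (e j) = inner B (e i) (e j)) -> A = B.
Proof.
move=> AB; have Eu : E \in unitmx.
  by have [] := mulmx1_unit frame_inv.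
have : E *m A *m E^T = E *m B *m E^T.
  by apply/matrixP => i j; rewrite -!inner_rows !rowK AB.
move=> /(congr1 (fun X => invmx E *m X *m invmx E^T)).
by rewrite !mulmxA !mulVmx // !mul1mx !mulmxK ?unitmx_tr.
Qed.

End FrameExpansion.

Lemma null_gram_swap e : null_gram e -> null_gram (e \o tau).
Proof. by move=> eg i j /=; rewrite eg (inj_eq perm_inj). Qed.

(** The reflection in the hyperplane orthogonal to w = k - e_0 is an isometry,
    and it exchanges the null vectors e_0 and k. It is defined because
    g(w, w) = - 2 g(k, e_0) is not zero. *)
Lemma null_gram_reflect e k : null_gram e -> inner G k k = 0 ->
  inner G k (e i0) != 0 -> exists2 e', null_gram e' & e' i0 = k.
Proof.
move=> eg k0 t0; set t := inner G k (e i0) in t0.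
(* The usual factor - 2 / g(w, w) is 1 / t. *)
pose w := k - e i0; pose rf v := v + (inner G v w / t) *: w.
have e00 : inner G (e i0) (e i0) = 0 by rewrite eg tpermL i01.
have wE v : inner G v w = inner G v k - inner G v (e i0).
  by rewrite /w -scaleN1r (innerDr GT) (innerZr GT) mulN1r.
have ww : inner G w w = - t - t.
  rewrite wE (inner_sym GT w) wE (inner_sym GT w) wE k0 e00.
  by rewrite (inner_sym GT (e i0)) -/t sub0r subr0.
have wdef : w = k - e i0 by [].
clearbody w.
exists (rf \o e) => [i j|] /=; last first.
  rewrite /rf wE e00 subr0 (inner_sym GT) -/t divff // scale1r wdef.
  by rewrite addrC subrK.
rewrite /rf !(innerDl, innerDr GT, innerZl, innerZr GT) ww eg.
rewrite (inner_sym GT w).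
by field.
Qed.

(** From a Lorentz frame u, take u_0 + u_1 and (u_1 - u_0) / 2, which needs no
    square roots, and keep the other vectors. A null vector orthogonal to the
    first two lies in the positive definite span of the others, so it is 0. *)
Lemma lorentzian_null_gram : lorentzian_mx G -> exists e, null_gram e /\
  forall k, inner G k k = 0 ->
    inner G k (e i0) = 0 -> inner G k (e i1) = 0 -> k = 0.
Proof.
move=> [P Pu PGP]; set D := diag_mx _ in PGP.
have PP i j : inner G (row i P) (row j P) =
    if i == j then if i == i0 then -1 else 1 else 0.
  rewrite inner_rows PGP !mxE ieq0.
  by case: (i == j); rewrite ?mulr1n ?mulr0n.
pose e i := if i == i0 then row i0 P + row i1 P
  else if i == i1 then 2^-1 *: (row i1 P - row i0 P) else row i P.
have e0 : e i0 = row i0 P + row i1 P by rewrite /e eqxx.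
have e1 : e i1 = 2^-1 *: (row i1 P + (-1) *: row i0 P).
  by rewrite /e eq_sym i01 eqxx scaleN1r.
have i10 : (i1 == i0) = false by rewrite eq_sym.
exists e; split=> [i j|k k0].
  have eE l : l != i0 -> l != i1 -> e l = row l P.
    by rewrite /e => /negbTE -> /negbTE ->.
  have bil := (innerDl, innerDr GT, innerZl, innerZr GT).
  have [->|ni0] := eqVneq i i0; last have [->|ni1] := eqVneq i i1.
  - case: tpermP => [->|->|/eqP nj0 /eqP nj1].
    + by rewrite e0 !bil !PP !eqxx i01 i10 /=; ring.
    + by rewrite e0 e1 !bil !PP !eqxx i01 i10 /=; field.
    + rewrite e0 eE // !bil !PP [i0 == j]eq_sym [i1 == j]eq_sym.
      by rewrite (negbTE nj0) (negbTE nj1) addr0.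
  - case: tpermP => [->|->|/eqP nj0 /eqP nj1].
    + by rewrite e0 e1 !bil !PP !eqxx i01 i10 /=; field.
    + by rewrite e1 !bil !PP !eqxx i01 i10 /=; field.
    + rewrite e1 eE // !bil !PP [i0 == j]eq_sym [i1 == j]eq_sym.
      by rewrite (negbTE nj0) (negbTE nj1) !mulr0 addr0 mulr0.
  - rewrite (eE i) //; case: tpermP => [->|->|/eqP nj0 /eqP nj1].
    + by rewrite e0 !bil !PP (negbTE ni0) (negbTE ni1) addr0.
    + by rewrite e1 !bil !PP (negbTE ni0) (negbTE ni1) !mulr0 addr0 mulr0.
    + by rewrite eE // PP (negbTE ni0); case: eqP.
rewrite e0 e1 !(innerDr GT, innerZr GT) => s0 d0.
have c0 : inner G k (row i0 P) = 0 by lra.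
pose c := k *m G *m P^T.
have cE i : c 0 i = inner G k (row i P).
  by rewrite /c /inner !mxE; apply: eq_bigr => j _; rewrite !mxE.
have DD : D *m D = 1%:M.
  rewrite mulmx_diag; apply/matrixP => i j; rewrite !mxE.
  by case: (i == j); rewrite ?mulr0n ?mulr1n //; case: ifP; rewrite ?mulrNN mulr1.
have GPD : G *m P^T *m (D *m P) = 1%:M.
  by apply: mulmx1C; rewrite -!mulmxA (mulmxA P) PGP DD.
have kc : k = c *m D *m P by rewrite /c -!mulmxA (mulmxA G) GPD mulmx1.
have : inner G k k = \sum_i c 0 i ^+ 2.
  have -> : inner G k k = (c *m D *m c^T) 0 0.
    have -> : inner G k k = (k *m G *m (c *m D *m P)^T) 0 0 by rewrite -kc.
    by rewrite !trmx_mul !mulmxA /D tr_diag_mx.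
  rewrite mxE /D; apply: eq_bigr => i _.
  rewrite mul_mx_diag [(\matrix_(_, _) _) _ _]mxE [(\row_a _) _ _]mxE.
  rewrite [c^T _ _]mxE ieq0 expr2.
  by case: eqP => [->|_]; rewrite ?cE ?c0 ?mulr1 ?mulr0 ?mul0r.
rewrite k0 => /esym/eqP; rewrite psumr_eq0 => [/allP c2|i _]; last exact: sqr_ge0.
rewrite kc (_ : c = 0) ?mul0mx //; apply/rowP => i.
by have := c2 i (mem_index_enum i); rewrite /= sqrf_eq0 [RHS]mxE => /eqP.
Qed.

(** By [lorentzian_null_gram], k is not orthogonal to both e_0 and e_1; after
    exchanging these if necessary, reflect e_0 to k. *)
Lemma null_frame_exists L k : lorentzian_mx G -> inner G k k = 0 -> k != 0 ->
  L k -> exists e, [/\ null_frame G L e, null_gram e & e i0 = k].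
Proof.
move=> /lorentzian_null_gram[e [eg e0k]] k0 kn0 Lk.
suff [e' eg' e0] : exists2 e', null_gram e' & e' i0 = k.
  by exists e'; split=> //; apply/null_frameP; split; rewrite ?e0.
have [ke0|] := eqVneq (inner G k (e i0)) 0; last exact: null_gram_reflect.
apply: (null_gram_reflect (null_gram_swap eg)) => //=; rewrite tpermL.
by apply: contraNneq kn0 => ke1; apply/eqP; exact: e0k.
Qed.

Lemma boost_weightE r (al : 'I_r -> 'I_n) :
  boost_weight al = \sum_(s < r) ((al s == i0)%:Z - (al s == i1)%:Z).
Proof.
rewrite big_split /= sumrN /boost_weight.
have cnt (i : 'I_n) : #|[pred s | al s == i]|%:Z = \sum_(s < r) (al s == i)%:Z.
  rewrite -sum1_card big_mkcond /= -natz natr_sum.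
  by apply: eq_bigr => s _; rewrite natz inE; case: eqP.
by congr (_ - _); rewrite -cnt; congr (_%:Z); apply: eq_card => s;
  rewrite !inE ?ieq0 ?ieq1.
Qed.

(** Weight - 2 is attained in rank 2 only by the index pair (1, 1), and
    g(k, .) is the covector that is 1 on e_1 and 0 on the rest of the frame. *)
Lemma typeN_rank1 L (T : tensor R n 2) k : lorentzian_mx G ->
  inner G k k = 0 -> k != 0 -> L k -> boost_order_eq G L T (- 2) ->
  exists2 s, s != 0 & mx_of_tensor T = s *: ((k *m G)^T *m (k *m G)).
Proof.
move=> lG k0 kn0 Lk [bo_le bo_ex].
have [e [ef eg e0]] := null_frame_exists lG k0 kn0 Lk.
have low (al : 'I_2 -> 'I_n) : boost_weight al <= - 2 ->
    al ord0 = i1 /\ al ord_max = i1.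
  rewrite boost_weightE big_ord_recl big_ord1.
  rewrite (_ : lift ord0 ord0 = ord_max); last exact/val_inj.
  move: (al ord0 == i0) (al ord_max == i0) => a0 a1.
  case: (al ord0 =P i1) => [->|_]; case: (al ord_max =P i1) => [->|_];
    by case: a0; case: a1.
have evalT (al : 'I_2 -> 'I_n) : eval_tensor T (e \o al) =
    inner (mx_of_tensor T) (e (al ord0)) (e (al ord_max)).
  exact: eval_tensor2.
exists (inner (mx_of_tensor T) (e i1) (e i1)).
  have [al [+ bal]] := bo_ex e ef.
  by rewrite evalT; have [|-> ->] := low al; rewrite ?bal.
apply: (frame_eqmx eg) => i j.
have tauE l : (i0 == tau l) = (l == i1).
  by rewrite -[X in X == _](tpermR i0 i1) (inj_eq perm_inj) eq_sym.
rewrite inner_scalemx inner_outer !pairing_mul -e0 !eg !tauE.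
have T0 : inner (mx_of_tensor T) (e i) (e j) != 0 -> i = i1 /\ j = i1.
  pose al (s : 'I_2) := if s == ord0 then i else j.
  have := bo_le e ef al; rewrite evalT => bal Tn0.
  exact: low (bal Tn0).
have [ii1|/eqP ni] := eqVneq i i1; last first.
  rewrite mul0r mulr0; apply/eqP; apply: contraT => /T0[ii1 _]; case: (ni ii1).
have [ji1|/eqP nj] := eqVneq j i1; last first.
  rewrite !mulr0; apply/eqP; apply: contraT => /T0[_ ji1]; case: (nj ji1).
by rewrite ii1 ji1 !mulr1.
Qed.

End Frames.

(** * Contraction with directions *)
Section Contractions.
Variables (R : realType) (n : nat) (U : set 'rV[R]_n).
Hypothesis Uo : open U.
Variable G : 'rV[R]_n -> 'M[R]_n.
Hypothesis sG : smoothmx U G.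
Hypothesis Gu : forall x, U x -> G x \in unitmx.
Hypothesis GT : forall y, U y -> (G y)^T = G y.
Hypothesis DG : forall a y, U y -> Dform G a G y = 0.
Variable k : 'rV[R]_n -> 'rV[R]_n.
Hypothesis sk : smoothmx U k.
Hypothesis k0 : forall y, U y -> inner (G y) (k y) (k y) = 0.

Lemma covd_vectE x X : covd_vect G k x X = \sum_a X 0 a *: Dvec G a k x.
Proof.
apply/rowP => b; rewrite mxE summxE; apply: eq_bigr => a _.
rewrite mxE DvecE pdm.unlock !mxE; congr (_ * (_ + _)).
by apply: eq_bigr => c _; rewrite mxE mulrC.
Qed.

Lemma covd_vect_sum (I : finType) (P : pred I) (s : I -> R)
    (v : I -> 'rV[R]_n) x :
  covd_vect G k x (\sum_(j | P j) s j *: v j) =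
  \sum_(j | P j) s j *: covd_vect G k x (v j).
Proof.
rewrite covd_vectE; under [RHS]eq_bigr do rewrite covd_vectE scaler_sumr.
rewrite [RHS]exchange_big; apply: eq_bigr => a _.
rewrite summxE scaler_suml; apply: eq_bigr => j _.
by rewrite mxE scalerA.
Qed.

Lemma inner_covd_vect x X v :
  inner (G x) (covd_vect G k x X) v =
  \sum_a X 0 a * inner (G x) (Dvec G a k x) v.
Proof.
by rewrite covd_vectE inner_suml; apply: eq_bigr => a _; rewrite innerZl.
Qed.

Lemma covd_vect_null x X : U x ->
  inner (G x) (covd_vect G k x X) (k x) = 0.
Proof.
move=> Ux; rewrite inner_covd_vect big1 // => a _.
by rewrite (Dvec_null Uo sG sk GT DG k0 _ Ux) mulr0.
Qed.

Variables (f : 'rV[R]_n -> R) (S : 'rV[R]_n -> tensor R n 2).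
Hypothesis sf : smooth U f.
Hypothesis SE : forall y, U y ->
  mx_of_tensor (S y) = f y *: ((k y *m G y)^T *m (k y *m G y)).

Variables (x : 'rV[R]_n) (Ux : U x).

Lemma contract_nabla2_rank1 (X v : 'rV[R]_n) : inner (G x) (k x) v = 0 ->
  \sum_b \sum_c X 0 b * X 0 c *
    inner (nabla2 G (fun y => mx_of_tensor (S y)) b c x) v v =
  2 * f x * inner (G x) (covd_vect G k x X) v ^+ 2.
Proof.
move=> kv; rewrite inner_covd_vect expr2 big_distrlr /= mulr_sumr.
apply: eq_bigr => b _; rewrite mulr_sumr; apply: eq_bigr => c _.
rewrite (nabla2_rank1 Uo sG Gu sk sf DG SE _ _ Ux kv kv).
by ring.
Qed.

Lemma contract_nabla3_rank1 (X w : 'rV[R]_n) : inner (G x) (k x) w = 0 ->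
  \sum_a \sum_b \sum_c X 0 a * X 0 b * X 0 c *
    inner (nabla3 G (fun y => mx_of_tensor (S y)) a b c x) (k x) w =
  - 3 * f x * inner (G x) (covd_vect G k x X) (covd_vect G k x X)
    * inner (G x) (covd_vect G k x X) w.
Proof.
move=> kw; set W := covd_vect G k x X.
pose h b c := X 0 b * X 0 c * inner (G x) (Dvec G b k x) (Dvec G c k x).
pose q a := X 0 a * inner (G x) (Dvec G a k x) w.
have WW : inner (G x) W W = \sum_b \sum_c h b c.
  rewrite {1}/W inner_covd_vect; apply: eq_bigr => b _.
  rewrite (inner_sym (GT Ux)) inner_covd_vect mulr_sumr.
  apply: eq_bigr => c _; rewrite (inner_sym (GT Ux)) /h; ring.
have Ww : inner (G x) W w = \sum_a q a by exact: inner_covd_vect.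
(* The three terms of nabla3_rank1 differ by the order of summation. *)
have H1 : \sum_a \sum_b \sum_c q a * h b c = inner (G x) W w * inner (G x) W W.
  rewrite WW Ww mulr_suml; apply: eq_bigr => a _.
  by rewrite mulr_sumr; apply: eq_bigr => b _; rewrite mulr_sumr.
have H2 : \sum_a \sum_b \sum_c q b * h a c = inner (G x) W w * inner (G x) W W.
  by rewrite exchange_big.
have H3 : \sum_a \sum_b \sum_c q c * h a b = inner (G x) W w * inner (G x) W W.
  rewrite -H2; apply: eq_bigr => a _; exact: exchange_big.
transitivity (- f x * (\sum_a \sum_b \sum_c q a * h b c
    + \sum_a \sum_b \sum_c q b * h a c + \sum_a \sum_b \sum_c q c * h a b)).
  rewrite -!big_split mulr_sumr; apply: eq_bigr => a _.
  rewrite -!big_split mulr_sumr; apply: eq_bigr => b _.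
  rewrite -!big_split mulr_sumr; apply: eq_bigr => c _ /=.
  rewrite (nabla3_rank1 Uo sG Gu sk sf GT DG k0 SE _ _ _ Ux kw) /q /h.
  by ring.
by rewrite H1 H2 H3; ring.
Qed.

End Contractions.

(** * Type N fields along a null congruence *)
Section TypeN.
Variables (R : realType) (n : nat) (M : manifold R n).
Variables (g : lorentzian_metric M) (i : chart_index M).
Local Notation G := (gram g i).

Lemma smooth_components (S : tensor_field M 2) :
  smoothmx (cod (atlas i)) (fun y => mx_of_tensor (S i y)).
Proof.
move=> a b.
apply: (eq_smooth (@cod_open _ _ _ (atlas i)) (f := fun x => S i x (idx2 a b))).
  by move=> x _; rewrite mxE.
exact: components_smooth.
Qed.

Lemma smooth_gram : smoothmx (cod (atlas i)) G.
Proof. exact: smooth_components. Qed.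

Lemma Dform_gram a y : cod (atlas i) y -> Dform G a G y = 0.
Proof.
move=> iy; rewrite -[LHS](mx_covd1 G (g i) a y).
by apply/matrixP => p q; rewrite !mxE; exact: covd_metric.
Qed.

Variables (c : line_field M) (S : tensor_field M 2).
Hypothesis hc : null_congruence g c.
Hypothesis hS : bo_eq g c S (- 2).
Variables (i0 i1 : 'I_n) (i0E : i0 = 0%N :> nat) (i1E : i1 = 1%N :> nat).

Section LocalSection.
Variables (U : set 'rV[R]_n) (k : 'rV[R]_n -> 'rV[R]_n).
Hypothesis ck : local_section c i U k.

Let Uo : open U. Proof. by have [] := ck. Qed.
Let Ui : U `<=` cod (atlas i). Proof. by have [] := ck. Qed.
Let sG : smoothmx U G := smoothmx_sub Ui smooth_gram.
Let Gu y : U y -> G y \in unitmx. Proof. by move=> /Ui; exact: gram_unit. Qed.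
Let GT y : U y -> (G y)^T = G y. Proof. by move=> /Ui; exact: gram_tr. Qed.
Let DG a y : U y -> Dform G a G y = 0.
Proof. by move=> /Ui; exact: Dform_gram. Qed.
Let sk : smoothmx U k.
Proof. by have [_ _ sk _] := ck; move=> a b; rewrite [a]ord1. Qed.

Lemma section_null y : U y -> inner (G y) (k y) (k y) = 0.
Proof.
have [_ _ _ ky] := ck; move=> Uy.
by apply: hc; [exact: Ui|have [] := ky y Uy].
Qed.

Lemma section_covd_null x X : U x ->
  inner (G x) (covd_vect G k x X) (k x) = 0.
Proof. exact: (covd_vect_null Uo sG GT DG sk section_null X). Qed.

Lemma section_rank1 y : U y -> exists2 s, s != 0 &
  mx_of_tensor (S i y) = s *: ((k y *m G y)^T *m (k y *m G y)).
Proof.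
have [_ _ _ ky] := ck; move=> Uy; have [kn0 fk] := ky y Uy.
have iy := Ui Uy.
exact: (typeN_rank1 (GT Uy) i0E i1E (metric_lorentzian g iy)
  (section_null Uy) kn0 fk (hS iy)).
Qed.

(** At each point S is a multiple of K K; near x, dividing one diagonal entry
    of S by the square of a non-zero component of K gives that multiple as a
    smooth function. Restricting the section to this neighbourhood is harmless
    because the claims on k are pointwise. *)
Lemma section_factor x : U x -> exists V f, [/\ V x, local_section c i V k,
  smooth V f, f x != 0 & forall y, V y ->
    mx_of_tensor (S i y) = f y *: ((k y *m G y)^T *m (k y *m G y))].
Proof.
have [_ _ skv ky] := ck; move=> Ux.
have sK : smoothmx U (fun y => k y *m G y) := smoothmxM Uo sk sG.
have [p Kp] : exists p, (k x *m G x) 0 p != 0.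
  apply/existsP; have [kn0 _] := ky x Ux; apply: contraNT kn0.
  rewrite negb_exists => /forallP Kx.
  rewrite -[k x](mulmxK (Gu Ux)) (_ : k x *m G x = 0) ?mul0mx //.
  by apply/rowP => b; rewrite [RHS]mxE; apply/eqP; have := Kx b; rewrite negbK.
have [V [[Vo Vx] VU]] : exists V, open_nbhs x V /\
    V `<=` [set y | U y /\ (k y *m G y) 0 p != 0].
  have Kn : nbhs x [set y | U y /\ (k y *m G y) 0 p != 0].
    have nU : nbhs x U := open_nbhs_nbhs (conj Uo Ux).
    have nK : \forall y \near x, (k y *m G y) 0 p != 0.
      exact: (@cvgr_neq0 _ _ _ (nbhs x) _ _ _
        (smooth_continuous (sK 0 p) Ux) Kp).
    exact: (filterI nU nK).
  by move: Kn; rewrite nbhsE => -[V ? ?]; exists V.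
have VUs : V `<=` U by move=> y /VU[].
have sp := smooth_sub VUs (sK 0 p).
have sV := smoothV Vo (fun y Vy => (VU y Vy).2) sp.
exists V, (fun y => mx_of_tensor (S i y) p p *
  (((k y *m G y) 0 p)^-1 * ((k y *m G y) 0 p)^-1)).
have fE y : V y -> forall s,
    mx_of_tensor (S i y) = s *: ((k y *m G y)^T *m (k y *m G y)) ->
    mx_of_tensor (S i y) p p *
      (((k y *m G y) 0 p)^-1 * ((k y *m G y) 0 p)^-1) = s.
  move=> Vy s ->; have [_ yp] := VU y Vy; set K := k y *m G y in yp *.
  have -> : (s *: (K^T *m K)) p p = s * (K 0 p * K 0 p).
    by clearbody K; rewrite mxE mxE big_ord1 mxE.
  by field.
split.
- exact: Vx.
- split=> [//|y Vy|b|y Vy]; first exact: Ui (VUs y Vy).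
    exact: smooth_sub (skv b).
  exact: ky (VUs y Vy).
- apply: (smoothM Vo) (smoothM Vo sV sV).
  by apply: smooth_sub (smooth_components S p p) => y Vy; exact: Ui (VUs y Vy).
- by have [s s0 Sx] := section_rank1 Ux; rewrite (fE x Vx s Sx).
- move=> y Vy.
  by have [s s0 Sy] := section_rank1 (VUs y Vy); rewrite (fE y Vy s Sy).
Qed.

Local Notation transverse j := ((j != i0) && (j != i1)).

Variable f : 'rV[R]_n -> R.
Hypothesis sf : smooth U f.
Hypothesis SE : forall y, U y ->
  mx_of_tensor (S i y) = f y *: ((k y *m G y)^T *m (k y *m G y)).
Variables (x : 'rV[R]_n) (Ux : U x) (e : 'I_n -> 'rV[R]_n).
Hypothesis f0 : f x != 0.
Hypotheses (ef : null_frame (G x) (fibre c i x) e) (e0k : e i0 = k x).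

Let eg : null_gram (G x) i0 i1 e.
Proof. by have /(null_frameP (G x) i0E i1E)[] := ef. Qed.

Let k_perp q : transverse q -> inner (G x) (k x) (e q) = 0.
Proof.
move=> /andP[q0 q1]; rewrite -e0k eg tpermD 1?eq_sym //.
by rewrite (negbTE q0).
Qed.

(** The component (0, 0, j, j) has boost weight 2. *)
Lemma nabla2_transverse j : transverse j ->
  bo_le g c (nabla g (nabla g S)) 0 ->
  inner (G x) (covd_vect G k x (k x)) (e j) = 0.
Proof.
move=> ji b2; have [j0 j1] := andP ji.
pose al (s : 'I_4) := if (s < 2)%N then i0 else j.
have : eval_tensor (nabla g (nabla g S) i x) (e \o al) = 0.
  apply/eqP; apply: contraT => /(b2 i x (Ui Ux) e ef).
  rewrite (boost_weightE i0E i1E) !big_ord_recl big_ord0 /al /=.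
  rewrite !eqxx (negbTE j0) (negbTE j1).
  have -> : (i0 == i1) = false by rewrite -val_eqE /= i0E i1E.
  by [].
rewrite [LHS]eval_covd2 /= /al !inordK //= e0k.
rewrite (contract_nabla2_rank1 Uo sG Gu DG sk sf SE Ux _ (k_perp ji)).
by move/eqP; rewrite !mulf_eq0 pnatr_eq0 (negbTE f0) /= orbb => /eqP.
Qed.

(** The component (j, j, j, 0, q) has boost weight 1. *)
Lemma nabla3_transverse j : transverse j ->
  bo_le g c (nabla g (nabla g (nabla g S))) 0 ->
  forall q, transverse q -> inner (G x) (covd_vect G k x (e j)) (e q) = 0.
Proof.
move=> ji b3; set W := covd_vect G k x (e j).
have Wprod q : transverse q -> inner (G x) W W * inner (G x) W (e q) = 0.
  move=> qi; have [[j0 j1] [q0 q1]] := (andP ji, andP qi).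
  pose al (s : 'I_5) := if (s < 3)%N then j else if s == 3 :> nat then i0 else q.
  have : eval_tensor (nabla g (nabla g (nabla g S)) i x) (e \o al) = 0.
    apply/eqP; apply: contraT => /(b3 i x (Ui Ux) e ef).
    rewrite (boost_weightE i0E i1E) !big_ord_recl big_ord0 /al /=.
    rewrite !eqxx (negbTE j0) (negbTE j1) (negbTE q0) (negbTE q1).
    have -> : (i0 == i1) = false by rewrite -val_eqE /= i0E i1E.
    by [].
  rewrite [LHS]eval_covd3 /= /al !inordK //= e0k.
  rewrite (contract_nabla3_rank1 Uo sG Gu GT DG sk section_null sf SE Ux _
    (k_perp qi)) -/W.
  move/eqP; rewrite -mulrA mulf_eq0 [_ * f x == 0]mulf_eq0 (negbTE f0).
  by rewrite oppr_eq0 pnatr_eq0 /= => /eqP.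
have Wk : inner (G x) W (e i0) = 0.
  by rewrite e0k; exact: section_covd_null.
move=> q qi; apply/eqP; apply: contraT => Wq.
have /eqP := Wprod q qi; rewrite mulf_eq0 (negbTE Wq) orbF.
rewrite (frame_norm (GT Ux) i0E i1E eg Wk) psumr_eq0 => [/allP W0|? _];
  last exact: sqr_ge0.
have := W0 q (mem_index_enum q); rewrite qi /= sqrf_eq0.
by rewrite (negbTE Wq).
Qed.

End LocalSection.

Hypothesis b2 : bo_le g c (nabla g (nabla g S)) 0.

Lemma rank1_and_frame_at U k x : local_section c i U k -> U x ->
  exists V f e, [/\ V x, local_section c i V k, smooth V f, f x != 0 &
    [/\ forall y, V y ->
        mx_of_tensor (S i y) = f y *: ((k y *m G y)^T *m (k y *m G y)),
      null_frame (G x) (fibre c i x) e, null_gram (G x) i0 i1 e & e i0 = k x]].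
Proof.
move=> ck Ux; have [_ Ui _ ky] := ck; have [kn0 fk] := ky x Ux.
have [V [f [Vx ckV sf f0 SE]]] := section_factor ck Ux.
have [e [ef eg e0k]] := null_frame_exists (gram_tr g (Ui x Ux)) i0E i1E
  (metric_lorentzian g (Ui x Ux)) (section_null ck Ux) kn0 fk.
by exists V, f, e.
Qed.

Lemma section_geodetic U k x : local_section c i U k -> U x ->
  exists a, covd_vect G k x (k x) = a *: k x.
Proof.
move=> /rank1_and_frame_at /[apply] -[V [f [e [Vx ck sf f0 [SE ef eg e0k]]]]].
exists (inner (G x) (covd_vect G k x (k x)) (e i1)).
rewrite -e0k; apply: (frame_null eg) => j j1; rewrite e0k.
have [->|j0] := eqVneq j i0; first by rewrite e0k; exact: (section_covd_null ck).
by apply: (nabla2_transverse ck sf SE Vx f0 ef e0k) => //; rewrite j0.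
Qed.

Lemma section_kundt U k x X :
  bo_le g c (nabla g (nabla g (nabla g S))) 0 ->
  local_section c i U k -> U x -> inner (G x) X (k x) = 0 ->
  exists a, covd_vect G k x X = a *: k x.
Proof.
move=> b3 ckU Ux Xk.
have [a0 geo] := section_geodetic ckU Ux.
have [V [f [e [Vx ck sf f0 [SE ef eg e0k]]]]] := rank1_and_frame_at ckU Ux.
have prop j : j != i1 -> exists a, covd_vect G k x (e j) = a *: k x.
  move=> j1; have [->|j0] := eqVneq j i0; first by exists a0; rewrite e0k.
  exists (inner (G x) (covd_vect G k x (e j)) (e i1)).
  rewrite -[in RHS]e0k; apply: (frame_null eg) => q q1.
  have [->|q0] := eqVneq q i0; first by rewrite e0k; exact: (section_covd_null ck).
  by apply: (nabla3_transverse ck sf SE Vx f0 ef e0k) => //; rewrite ?j0 ?q0.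
rewrite -e0k in Xk; rewrite (frame_perp eg Xk) covd_vect_sum.
elim/big_ind: _ => [|_ _ [a1 ->] [a2 ->]|j j1].
- by exists 0; rewrite scale0r.
- by exists (a1 + a2); rewrite scalerDl.
- have [a ->] := prop j j1.
  by exists (inner (G x) X (e (tperm i0 i1 j)) * a); rewrite scalerA.
Qed.

End TypeN.

Theorem proposition3 (R : realType) (n : nat) (hn : (3 <= n)%N)
    (M : manifold R n) (g : lorentzian_metric M)
    (c : line_field M) (hc : null_congruence g c)
    (S : tensor_field M 2) (hsym : symmetric_field S)
    (hS : bo_eq g c S (- 2)) :
  bo_le g c (nabla g (nabla g S)) 0 ->
  geodetic g c /\
  (bo_le g c (nabla g (nabla g (nabla g S))) 0 -> kundt g c).
Proof.
move=> b2; pose i0 := Ordinal (leq_trans (isT : (0 < 3)%N) hn).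
pose i1 := Ordinal (leq_trans (isT : (1 < 3)%N) hn).
have i0E : i0 = 0%N :> nat by [].
have i1E : i1 = 1%N :> nat by [].
split=> [i U k ck x Ux|b3 i U k ck x Ux X Xperp].
  exact: (section_geodetic hc hS i0E i1E b2 ck Ux).
apply: (section_kundt hc hS i0E i1E b2 b3 ck Ux).
by apply: Xperp; have [_ _ _ /(_ x Ux)[]] := ck.
Qed.
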